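(* If $\alpha$ is a composition of $n$ obtained by shuffling a partition and $(1^k)$ for some $k \ge 0$, then there exists a unique $H_n(0)$-module homomorphism $\tilde{\delta}: X_\alpha \to \mathbf{Y}_\alpha$ such that $\delta = \tilde{\delta} \circ \Gamma$ (as maps $\mathcal V_\alpha\to\mathbf Y_\alpha$).
   Context: Let $n$ be a nonnegative integer. $H_n(0)$ is the associative unital $\mathbb C$-algebra generated by $\pi_1,\dots,\pi_{n-1}$ with relations $\pi_i^2=\pi_i$, $\pi_i\pi_{i+1}\pi_i=\pi_{i+1}\pi_i\pi_{i+1}$, $\pi_i\pi_j=\pi_j\pi_i$ for $|i-j|\ge2$. A composition $\alpha=(\alpha_1,\dots,\alpha_l)$ of $n$ is a finite sequence of positive integers with sum $n$; $\alpha^{\mathrm r}=(\alpha_l,\dots,\alpha_1)$. It is obtained by shuffling a partition $\lambda$ and $(1^k)$ if it is an interleaving of the sequence $\lambda$ (in its weakly decreasing order) with $k$ ones. The composition diagram consists of left-justified rows with $\alpha_i$ cells in the $i$th row from the bottom; $(i,j)$ denotes the cell in the $i$th row from the bottom and $j$th column from the left. For a filling $T$ with $1,\dots,n$, $s_i\cdot T$ is obtained by swapping $i$ and $i+1$. Tableaux (fillings of the composition diagram of $\alpha$ with $1,\dots,n$, each once, rows increasing from left to right): $\mathrm{SIT}(\alpha)$: first column increases from bottom to top. $\mathrm{SET}(\alpha)$: every column increases from bottom to top. Modules. $\mathcal V_\alpha=\mathbb C\,\mathrm{SIT}(\alpha)$ with $\pi_i\cdot\mathcal T=\mathcal T$ if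 $i$ is weakly above $i+1$; $0$ if $i,i+1$ are both in the first column (with $i$ below $i+1$); $s_i\cdot\mathcal T$ otherwise. $X_\alpha=\mathbb C\,\mathrm{SET}(\alpha)$ with $\pi_i\cdot T=T$ if $i$ is strictly left of $i+1$; $0$ if $i,i+1$ are in the same column; $s_i\cdot T$ if $i$ is strictly right of $i+1$. $\Gamma:\mathcal V_\alpha\to X_\alpha$ is the linear map with $\Gamma(\mathcal T)=\mathcal T$ if $\mathcal T\in\mathrm{SET}(\alpha)$ and $0$ otherwise; it is known to be a surjective $H_n(0)$-module homomorphism. Insertion. Permutations are written as words; $w_0\in\mathfrak S_n$ is the longest element, so $\sigma w_0$ is the reversed word. A Young composition tableau is a filling $T$ of a composition diagram with positive integers whose rows weakly increase, whose first column strictly increases from bottom to top, and such that for cells $(i,k+1),(j,k)$ with $i<j$, if $T(i,k+1)\ge T(j,k)$ then $(j,k+1)$ is a cell and $T(i,k+1)>T(j,k+1)$. For such $T$ and a positive integer $k$, define $k\to T$: list the cells $(c_1,d_1),(c_2,d_2),\dots$ of $T$ (before insertion) by decreasing column index $d$ and, within a column, decreasing row index $c$. Set $k_0:=k$ and process $i=1,2,\dots$: if $(c_i,d_i+1)$ is not a cell and $T(c_i,d_i)\le k_0$, place $k_0$ in a new cell $(c_i,d_i+1)$ and stop; if $(c_i,d_i+1)$ is a cell and $T(c_i,d_i)\le k_0<T(c_i,d_i+1)$, interchange $k_0$ with the entry in $(c_i,d_i+1)$ and continue; otherwise continue. If no stop occurs, create a new row with a single cell containing $k_0$, positioned so that the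 first column strictly increases from bottom to top. For $\sigma\in\mathfrak S_n$, $\hat{\mathsf P}(\sigma)$ is obtained from the empty tableau by inserting $\sigma(1),\dots,\sigma(n)$ successively. $\hat{\mathsf Q}(\sigma)$ is built simultaneously from the empty filling: at step $k$, if the new cell of $\hat{\mathsf P}$ lies in column $c=1$, add to $\hat{\mathsf Q}$ a new row with a single cell containing $k$, positioned so that the first column increases from bottom to top; if $c>1$, append $k$ at the end of the topmost row of $\hat{\mathsf Q}$ having exactly $c-1$ cells. $\mathbf Y_\alpha$ and $\delta$. $\mathcal T_\alpha$ is the filling of the composition diagram of $\alpha$ with $1,\dots,n$ from left to right in each row, starting with the bottommost row and going up. $\mathcal K_\alpha=\{\sigma\in\mathfrak S_n\mid\mathrm{sh}(\hat{\mathsf P}(\sigma w_0))=\alpha,\ \hat{\mathsf Q}(\sigma w_0)=\mathcal T_{\alpha^{\mathrm r}}\}$. $\mathrm{Des}_L(\sigma)=\{i\mid i\text{ is to the right of }i+1\text{ in the word of }\sigma\}$, and $s_i=(i,i+1)$. $\mathbf Y_\alpha=\mathbb C\mathcal K_\alpha$ with $\pi_i\cdot\sigma=\sigma$ if $i\in\mathrm{Des}_L(\sigma)$; $s_i\sigma$ if $i\notin\mathrm{Des}_L(\sigma)$ and $s_i\sigma\in\mathcal K_\alpha$; $0$ otherwise. For a filling $T$, $\mathsf{w_r}(T)$ is the word obtained by reading each row from right to left, starting with the bottommost row and going up. $\delta:\mathcal V_\alpha\to\mathbf Y_\alpha$ is the surjective $H_n(0)$-module homomorphism with $\delta(\mathcal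 T)=\mathsf{w_r}(\mathcal T)$ if $\mathsf{w_r}(\mathcal T)\in\mathcal K_\alpha$ and $\delta(\mathcal T)=0$ otherwise, for $\mathcal T\in\mathrm{SIT}(\alpha)$. *)

(* Defs.v *)
From HB Require Import structures.
From mathcomp Require Import all_boot all_order all_algebra.
From mathcomp Require Import reals complex.

Set Implicit Arguments.
Unset Strict Implicit.
Unset Printing Implicit Defensive.

Import GRing.Theory.

Definition is_composition (n : nat) (alpha : seq nat) : bool :=
  all (leq 1) alpha && (sumn alpha == n).

Definition is_partition (lam : seq nat) : bool :=
  all (leq 1) lam && sorted geq lam.

(* m marks the positions of u that are filled, in order, by the entries of s;
   the entries of t fill the remaining positions, in order. *)
Definition is_shuffle (s t u : seq nat) : Prop :=
  exists m : bitseq,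
    [/\ size m = size u, mask m u = s & mask (map negb m) u = t].

(* A filling is the list of its rows from bottom to top, each row
   being listed from left to right; its shape is then a composition diagram.
   Row and column indices are 0-based; entries are positive integers. *)

Notation tableau := (seq (seq nat)).

(* The fillings of the diagram of alpha with 1, ..., n, each used once,
   for alpha a composition of n (see mem_fillings). *)
Definition fillings (n : nat) (alpha : seq nat) : seq tableau :=
  [seq reshape alpha s | s <- permutations (iota 1 n)].

Lemma mem_fillings (n : nat) (alpha : seq nat) (T : tableau) :
  is_composition n alpha ->
  (T \in fillings n alpha) =
  (shape T == alpha) && perm_eq (flatten T) (iota 1 n).
Proof.
case/andP=> _ /eqP sz; apply/mapP/andP=> [[s]|[/eqP sh pT]].
  rewrite mem_permutations => ps ->.
  have szs : size s = sumn alpha by rewrite (perm_size ps) size_iota sz.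
  by rewrite reshapeKl ?szs // reshapeKr ?szs.
by exists (flatten T); rewrite ?mem_permutations // -sh flattenK.
Qed.

Definition rows_increase (T : tableau) : bool := all (sorted ltn) T.

(* The entries of column j, from bottom to top; rows that are too short to
   meet column j are skipped. *)
Definition column (T : tableau) (j : nat) : seq nat :=
  [seq nth 0 r j | r <- T & j < size r].

Definition SIT (n : nat) (alpha : seq nat) : seq tableau :=
  [seq T <- fillings n alpha | rows_increase T && sorted ltn (column T 0)].

Definition SET (n : nat) (alpha : seq nat) : seq tableau :=
  [seq T <- fillings n alpha |
    rows_increase T && all (fun j => sorted ltn (column T j)) (iota 0 n)].

Definition row_of (T : tableau) (x : nat) : nat := find (fun r => x \in r) T.
Definition col_of (T : tableau) (x : nat) : nat :=
  index x (nth [::] T (row_of T x)).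

Definition swap (i x : nat) : nat :=
  if x == i then i.+1 else if x == i.+1 then i else x.
Definition swap_tab (i : nat) (T : tableau) : tableau := map (map (swap i)) T.

(* A new row with the single cell k, placed so that the first column
   increases from bottom to top. *)
Definition new_row (k : nat) (T : tableau) : tableau :=
  [seq r <- T | head 0 r < k] ++ [:: k] :: [seq r <- T | k <= head 0 r].

Definition is_cell (T : tableau) (c d : nat) : bool := d < size (nth [::] T c).
Definition entry (T : tableau) (c d : nat) : nat := nth 0 (nth [::] T c) d.

(* This also creates the cell (c, d) when d is the length of row c. *)
Definition set_entry (T : tableau) (c d x : nat) : tableau :=
  set_nth [::] T c (set_nth 0 (nth [::] T c) d x).

(* The cells by decreasing column and, in each column, decreasing row. *)
Definition scan_cells (T : tableau) : seq (nat * nat) :=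
  [seq (c, d) | d <- rev (iota 0 (foldr maxn 0 (shape T))),
                c <- [seq c <- rev (iota 0 (size T)) | is_cell T c d]].

(* Returns the new tableau and the 0-based column of the new cell. *)
Fixpoint scan (cells : seq (nat * nat)) (k0 : nat) (T : tableau) :
    tableau * nat :=
  if cells is (c, d) :: cells' then
    if ~~ is_cell T c d.+1 && (entry T c d <= k0) then
      (set_entry T c d.+1 k0, d.+1)
    else if [&& is_cell T c d.+1, entry T c d <= k0 & k0 < entry T c d.+1] then
      scan cells' (entry T c d.+1) (set_entry T c d.+1 k0)
    else scan cells' k0 T
  else (new_row k0 T, 0).

Definition insertion (k : nat) (T : tableau) : tableau * nat :=
  scan (scan_cells T) k T.

(* Appends k at the end of the topmost row of Q having exactly d cells. *)
Fixpoint append_topmost (d k : nat) (Q : tableau) : tableau :=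
  if Q is r :: Q' then
    if d \in shape Q' then r :: append_topmost d k Q'
    else if size r == d then rcons r k :: Q' else r :: Q'
  else [::].

(* kx is the pair (step number, inserted letter). *)
Definition PQ_step (PQ : tableau * tableau) (kx : nat * nat) :
    tableau * tableau :=
  let: (P, d) := insertion kx.2 PQ.1 in
  (P, if d is 0 then new_row kx.1 PQ.2 else append_topmost d kx.1 PQ.2).

Definition PQ_hat (w : seq nat) : tableau * tableau :=
  foldl PQ_step ([::], [::]) (zip (iota 1 (size w)) w).
Definition P_hat (w : seq nat) : tableau := (PQ_hat w).1.
Definition Q_hat (w : seq nat) : tableau := (PQ_hat w).2.

(* Permutations of {1, ..., n} are handled through their words, that is, as
   the elements of permutations (iota 1 n). The word of s_i sigma is obtained
   by exchanging the letters i and i + 1, and that of sigma w_0 by reversal. *)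

Definition T_can (n : nat) (alpha : seq nat) : tableau :=
  reshape alpha (iota 1 n).

Definition K_set (n : nat) (alpha : seq nat) : seq (seq nat) :=
  [seq s <- permutations (iota 1 n) |
    (shape (P_hat (rev s)) == alpha) && (Q_hat (rev s) == T_can n (rev alpha))].

Definition Des_L (s : seq nat) (i : nat) : bool := index i.+1 s < index i s.

Definition w_r (T : tableau) : seq nat := flatten (map rev T).

Local Open Scope ring_scope.

Notation span_on F B := {ffun seq_sub B -> F^o}.

Section FreeSpace.
Variables (F : fieldType) (I : choiceType) (B : seq I).

(* The basis vector indexed by x if x is in B, and 0 otherwise. *)
Definition bvec (x : I) : span_on F B := [ffun t => (val t == x)%:R].

Variables (W : vectType F) (g : I -> W).

Definition linext_fun (v : span_on F B) : W := \sum_t v t *: g (val t).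

Fact linext_fun_is_linear : linear linext_fun.
Proof.
move=> a u v; rewrite /linext_fun scaler_sumr -big_split /=.
by apply: eq_bigr => t _; rewrite !ffunE scalerDl scalerA.
Qed.

HB.instance Definition _ :=
  GRing.isLinear.Build F (span_on F B) W _ linext_fun linext_fun_is_linear.

(* The linear map sending each basis vector bvec x to g x. *)
Definition linext : 'Hom(span_on F B, W) := linfun linext_fun.

Lemma linext_bvec (x : I) : x \in B -> linext (bvec x) = g x.
Proof.
move=> Bx; rewrite lfunE /= /linext_fun (bigD1 (SeqSub Bx)) //= ffunE eqxx.
rewrite scale1r big1 ?addr0 // => t /negPf nt; rewrite ffunE.
by rewrite (_ : (val t == x) = (t == SeqSub Bx)) // nt scale0r.
Qed.

End FreeSpace.

Arguments bvec F {I} B x.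
Arguments linext {F I B W} g.
Arguments linext_bvec {F I B W} g {x}.

Section Modules.
Variables (F : fieldType) (n : nat) (alpha : seq nat).

Definition V_mod := span_on F (SIT n alpha).
Definition X_mod := span_on F (SET n alpha).
Definition Y_mod := span_on F (K_set n alpha).

(* The action of pi_i, for 0 < i < n. Weakly above means weakly larger row
   index, as rows are numbered from the bottom. *)

Definition V_pi (i : nat) : 'End(V_mod) :=
  linext (fun T =>
    if (row_of T i.+1 <= row_of T i)%N then bvec F (SIT n alpha) T
    else if (col_of T i == 0%N) && (col_of T i.+1 == 0%N) then 0
    else bvec F (SIT n alpha) (swap_tab i T)).

Definition X_pi (i : nat) : 'End(X_mod) :=
  linext (fun T =>
    if (col_of T i < col_of T i.+1)%N then bvec F (SET n alpha) T
    else if col_of T i == col_of T i.+1 then 0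
    else bvec F (SET n alpha) (swap_tab i T)).

Definition Y_pi (i : nat) : 'End(Y_mod) :=
  linext (fun s =>
    if Des_L s i then bvec F (K_set n alpha) s
    else if map (swap i) s \in K_set n alpha
    then bvec F (K_set n alpha) (map (swap i) s)
    else 0).

Definition Gamma : 'Hom(V_mod, X_mod) :=
  linext (fun T => if T \in SET n alpha then bvec F (SET n alpha) T else 0).

Definition delta : 'Hom(V_mod, Y_mod) :=
  linext (fun T =>
    if w_r T \in K_set n alpha then bvec F (K_set n alpha) (w_r T) else 0).

End Modules.

(* H_n(0) is presented by the generators pi_1, ..., pi_(n-1), so a module over
   it amounts to a vector space with operators piU 1, ..., piU n.-1 satisfying
   the defining relations, and, as the pi_i generate H_n(0), a linear map is
   H_n(0)-linear exactly when it commutes with each of these operators. The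
   relations are not needed to say that a map is a homomorphism. *)
Definition hecke0_hom (F : fieldType) (n : nat) (U W : vectType F)
    (piU : nat -> 'End(U)) (piW : nat -> 'End(W)) (f : 'Hom(U, W)) : Prop :=
  forall i : nat, (0 < i < n)%N -> forall u : U, f (piU i u) = piW i (f u).

(* Main.v *)
Require Import Defs.
From mathcomp Require Import all_boot all_order all_algebra.
From mathcomp Require Import reals complex.
From mathcomp Require Import zify.

(* The heart of the matter is an explicit description of the words w_r(T) lying
   in K_alpha, for T a row-increasing filling of the diagram of alpha: they are
   those for which, whenever a row r lies below a row s, r_i < s_i at all common
   columns i and, if r is strictly longer than s, even r_(i+1) < s_i at all
   columns i of s. The first condition says that T is in SET(alpha), so delta
   kills the kernel of Gamma; and both conditions survive moving i below i + 1,
   so the image of K_alpha in SET(alpha) is closed downwards for the action.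

   The description is proved by inserting the rows of T from top to bottom.
   The recording tableau forces the letters of each row to create cells in the
   columns 1, 2, ... in turn, and the shape condition, read backwards from the
   last letter, forces these cells to lie in a new bottom row. As the parts of
   alpha larger than 1 decrease, this prevents the letters of a row from ever
   reaching a shorter row, and then only rows of equal length exchange entries.
   So the set of entries of T in column i of its rows of length q is also that
   of the insertion tableau, although the two tableaux differ. *)

Set Implicit Arguments.
Unset Strict Implicit.
Unset Printing Implicit Defensive.

(** * Insertion, column by column *)

(** The two active cases of [scan] in one test: either [r] ends in column [d] and the letter stops
    behind it, or the letter displaces the entry in column [d.+1]. *)
Definition hit (d k : nat) (r : seq nat) : bool :=
  [&& d < size r, nth 0 r d <= k & (size r == d.+1) || (k < nth 0 r d.+1)].

(* One column of the scan: [k] runs through the cells of column [d], from top to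
   bottom, so the recursion treats the rows above [r] first. The result is [None]
   when the letter has come to rest in column [d.+1]. *)
Fixpoint pass (d k : nat) (P : tableau) : tableau * option nat :=
  if P is r :: P1 then
    let: (P', o) := pass d k P1 in
    if o is Some k' then
      if hit d k' r then
        (set_nth 0 r d.+1 k' :: P',
         if size r == d.+1 then None else Some (nth 0 r d.+1))
      else (r :: P', Some k')
    else (r :: P', None)
  else ([::], Some k).

Fixpoint passes (D k : nat) (P : tableau) : tableau * nat :=
  if D is d.+1 then
    let: (P', o) := pass d k P in
    if o is Some k' then passes d k' P' else (P', d.+1)
  else (new_row k P, 0).

Definition width (P : tableau) : nat := foldr maxn 0 (shape P).

Lemma pass_shape d k P P' k' :
  pass d k P = (P', Some k') -> shape P' = shape P.
Proof.
elim: P P' k' => [|r P IH] P' k' /=; first by case=> <-.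
case E: (pass d k P) => [P1 [k1|]] //; rewrite /hit.
case: ifP => [/and3P[lt _ _] [<-] | _ [<- _]] /=; last by rewrite (IH _ _ E).
rewrite (IH _ _ E) size_set_nth; case: eqP => // ne _.
by congr cons; lia.
Qed.

(** The cells are listed before the insertion, but a bump does not alter the shape [sh], so the list
    stays valid until the letter stops. The rows [pre] lie below the part already scanned and are
    carried along for the induction. *)
Lemma scan_pass d sh pre P cs k :
  shape (pre ++ P) = sh ->
  scan ([seq (c, d) | c <- rev (iota (size pre) (size P)) & d < nth 0 sh c] ++ cs)
    k (pre ++ P) =
  let: (P', o) := pass d k P in
  if o is Some k' then scan cs k' (pre ++ P') else (pre ++ P', d.+1).
Proof.
elim: P pre cs k => [|r P IH] pre cs k //= Esh.
rewrite rev_cons -cats1 filter_cat map_cat -catA -cat_rcons.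
rewrite -(size_rcons pre r) IH ?cat_rcons //.
case E: (pass d k P) => [P' [k'|]]; rewrite cat_rcons //.
have Hs : nth 0 sh (size pre) = size r.
  by rewrite -Esh /shape map_cat nth_cat size_map ltnn subnn.
have Er : nth [::] (pre ++ r :: P') (size pre) = r.
  by rewrite nth_cat ltnn subnn.
have Es x : set_entry (pre ++ r :: P') (size pre) d.+1 x
    = pre ++ set_nth 0 r d.+1 x :: P'.
  rewrite /set_entry Er; elim: (pre) => //= a p ->//.
rewrite /= Hs /hit; case: ltnP => //= ltd.
rewrite /is_cell /entry Er Es; case: leqP => /= h; rewrite ?andbF //=.
  have -> : size r == d.+1 by rewrite eqn_leq h ltd.
  by rewrite /= andbT; case: ifP.
have -> : (size r == d.+1) = false by rewrite gtn_eqF.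
by case: ifP.
Qed.

Lemma insertion_passes k P : insertion k P = passes (width P) k P.
Proof.
rewrite /insertion /scan_cells -/(width P).
set sh := shape P.
have -> : [seq (c, d) | d <- rev (iota 0 (width P)),
            c <- [seq c <- rev (iota 0 (size P)) | is_cell P c d]] =
    flatten [seq [seq (c, d) | c <- rev (iota 0 (size P)) & d < nth 0 sh c]
             | d <- rev (iota 0 (width P))].
  congr flatten; apply: eq_map => d; congr map; apply: eq_in_filter => c.
  rewrite mem_rev mem_iota /= /is_cell => lt.
  by rewrite (nth_map [::]).
have : shape P = sh by [].
have -> : size P = size sh by rewrite size_map.
move: (width P) => D; move: sh => sh.
elim: D k P => [|D IH] k P Esh //.
rewrite -[D.+1]addn1 iotaD rev_cat /= addn1 /=.
have := @scan_pass D sh [::] P (flatten [seq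
  [seq (c, d) | c <- rev (iota 0 (size sh)) & d < nth 0 sh c] | d <- rev (iota 0 D)])
  k Esh.
rewrite /= -{1}(size_map size P) -/(shape P) Esh => ->.
case E: (pass D k P) => [P' [k'|]] //.
by apply: IH; rewrite (pass_shape E).
Qed.

(** The monotonicity of insertion: with time a row only gets longer and the entry at a fixed
    position only decreases. A lower bound on later entries thus holds for the earlier ones too. *)
Definition shrinks (r s : seq nat) : Prop :=
  size r <= size s /\ forall i, i < size r -> nth 0 s i <= nth 0 r i.

Lemma shrinks_refl r : shrinks r r.
Proof. by split. Qed.

Lemma shrinks_trans s r t : shrinks r s -> shrinks s t -> shrinks r t.
Proof.
case=> rs hrs [st hst]; split=> [|i lti]; first exact: leq_trans st.
exact: leq_trans (hst i (leq_trans lti rs)) (hrs i lti).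
Qed.

Lemma hit_shrinks d k r : hit d k r -> shrinks r (set_nth 0 r d.+1 k).
Proof.
case/and3P=> lt _ h; rewrite /shrinks size_set_nth leq_maxr; split=> // i lti.
rewrite nth_set_nth /=; case: eqP => // ei; subst i.
by case/orP: h => [/eqP e|/ltnW //]; rewrite e ltnn in lti.
Qed.

Lemma pass_shrinks d k P P' o r :
  pass d k P = (P', o) -> r \in P ->
  exists2 s, s \in P' & shrinks r s /\ (o -> size s = size r).
Proof.
elim: P P' o => [|q P IH] P' o //=.
case E: (pass d k P) => [P1 [k1|]]; last first.
  case=> <- <-; rewrite inE => /predU1P[->|rP].
    by exists q; rewrite ?mem_head //; split=> //; apply: shrinks_refl.
  by have [s s1 hs] := IH _ _ E rP; exists s; rewrite // inE s1 orbT.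
have keep : r \in P -> forall q', exists2 s, s \in q' :: P1 &
    shrinks r s /\ size s = size r.
  move=> rP q'; have [s s1 [hs es]] := IH _ _ E rP.
  by exists s; [rewrite inE s1 orbT | split=> //; apply: es].
case: ifP => [h|_] [<- <-]; rewrite inE => /predU1P[->|/keep kr].
- exists (set_nth 0 q d.+1 k1); rewrite ?mem_head //.
  split; first exact: hit_shrinks.
  case: eqP => //= ne _; rewrite size_set_nth; case/and3P: h; lia.
- by have [s sP [? ?]] := kr (set_nth 0 q d.+1 k1); exists s.
- by exists q; rewrite ?mem_head //; split=> //; apply: shrinks_refl.
- by have [s sP [? ?]] := kr q; exists s.
Qed.

Lemma pass_le d k P P' k' : pass d k P = (P', Some k') -> k <= k'.
Proof.
elim: P P' k' => [|q P IH] P' k' /=; first by case=> _ ->.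
case E: (pass d k P) => [P1 [k1|]] //; have le1 := IH _ _ E.
case: ifP => [/and3P[_ _ h]|_] [_]; last by move=> <-.
by case: eqP h => //= _ lt [<-]; apply: leq_trans (ltnW lt).
Qed.

Lemma pass_heads d k P P' o :
  pass d k P = (P', o) -> map (head 0) P' = map (head 0) P.
Proof.
elim: P P' o => [|q P IH] P' o /=; first by case=> <-.
case E: (pass d k P) => [P1 [k1|]]; last by case=> <- _; rewrite /= (IH _ _ E).
case: ifP => [/and3P[lt _ _]|_] [<- _] /=; rewrite (IH _ _ E) //.
by case: (q) lt.
Qed.

Lemma pass_skip d k P :
  (forall r, r \in P -> d < size r -> k < nth 0 r d) ->
  pass d k P = (P, Some k).
Proof.
elim: P => //= q P IH h; rewrite IH => [|r rP]; last first.
  by apply: h; rewrite inE rP orbT.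
rewrite /hit; case: ltnP => //= lt.
by rewrite leqNgt h ?mem_head.
Qed.

Lemma sorted_set_nth d k r :
  sorted leq r -> hit d k r -> sorted leq (set_nth 0 r d.+1 k).
Proof.
move=> sr /and3P[lt le h]; apply/(sortedP 0) => i.
rewrite size_set_nth !nth_set_nth /= => lti.
have st := sorted_leq_nth leq_trans leqnn 0 sr.
case: eqP => [ei|ni].
  have {}ei : i = d.+1 by []. 
  have [_|e2] := eqVneq i.+1 d.+1; first by lia.
  have lt2 : d.+2 < size r by lia.
  case/orP: h => [/eqP e|h]; first by lia.
  by rewrite ei; apply: leq_trans (ltnW h) (st _ _ _ _ _); rewrite ?inE; lia.
have [[ei]|ne] := eqVneq i.+1 d.+1; first by rewrite ei.
by apply: st; rewrite ?inE; lia.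
Qed.

(** The inequalities are weak so that the invariant survives the insertion of an arbitrary letter,
    repeated or not. *)
Definition wf (P : tableau) : bool :=
  all (fun r => (0 < size r) && sorted leq r) P && sorted leq (map (head 0) P).

Lemma wf_row P r : wf P -> r \in P -> 0 < size r /\ sorted leq r.
Proof. by case/andP=> /allP h _ /h /andP[]. Qed.

Lemma pass_wf d k P P' o : pass d k P = (P', o) -> wf P -> wf P'.
Proof.
move=> E /andP[a h]; rewrite /wf (pass_heads E) h andbT.
elim: P P' o a {h} E => [|q P IH] P' o /=; first by move=> _ [<-].
case/andP=> hq aP.
case E: (pass d k P) => [P1 [k1|]]; last by case=> <- _ /=; rewrite hq (IH _ _ aP E).
case: ifP => [h|_] [<- _] /=; rewrite (IH _ _ aP E) ?hq //.
case/andP: hq => sq stq; rewrite sorted_set_nth //.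
by rewrite size_set_nth andbT; lia.
Qed.

Lemma mem_set_nthE (r : seq nat) i k x :
  i <= size r -> x \in set_nth 0 r i k -> x = k \/ x \in r.
Proof.
elim: r i => [|a r IH] [|i] //=; rewrite !inE.
- by move=> _ /eqP; left.
- by move=> _ /predU1P[->|->]; rewrite ?eqxx ?orbT; auto.
move=> lt /predU1P[->|]; first by rewrite eqxx; right.
by case/(IH i lt) => [->|->]; rewrite ?orbT; auto.
Qed.

Lemma pass_sub d k P P' o : pass d k P = (P', o) ->
  {subset flatten P' <= k :: flatten P} /\
  (if o is Some k' then k' \in k :: flatten P else true).
Proof.
elim: P P' o => [|q P IH] P' o /=; first by case=> <- <-; rewrite mem_head.
case E: (pass d k P) => [P1 o1]; have [h1 h2] := IH _ _ E.
have inP x : x \in k :: flatten P -> x \in k :: q ++ flatten P.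
  by rewrite !inE mem_cat => /orP[->|->]; rewrite ?orbT.
have inq x : x \in q -> x \in k :: q ++ flatten P.
  by rewrite !inE mem_cat => ->; rewrite orbT.
case: o1 E h2 => [k1|] E h2; last first.
  case=> <- <-; split=> // x /=; rewrite mem_cat => /orP[/inq //|/h1].
  exact: inP.
case: ifP => [/and3P[lt _ h]|_] [<- <-]; last first.
  split=> [x|]; last exact: inP.
  by rewrite /= mem_cat => /orP[/inq //|/h1]; apply: inP.
split=> [x|].
  rewrite /= mem_cat => /orP[|/h1]; last exact: inP.
  by case/mem_set_nthE => // [->|/inq //]; apply: inP.
case: (size q =P d.+1) => // ne; apply: inq; apply: mem_nth.
by rewrite ltn_neqAle lt andbT; apply/eqP => e; apply: ne.
Qed.

(** The letter in hand never decreases during a pass, so a row ending in column [d] with an entry at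
    most [k] would have stopped it. *)
Lemma pass_nostop d k P P' k' r :
  pass d k P = (P', Some k') -> r \in P -> size r = d.+1 -> k < nth 0 r d.
Proof.
elim: P P' k' => [|q P IH] P' k' //=.
case E: (pass d k P) => [P1 [k1|]] //.
move=> h; rewrite inE => /predU1P[er|rP sr]; last exact: (IH _ _ E).
subst q => sr; move: h; rewrite /hit sr ltnSn eqxx /= andbT.
case: (leqP (nth 0 r d) k1) => // lt _; exact: leq_ltn_trans (pass_le E) lt.
Qed.

(** The topmost row whose entry in column [d] is at most [k] is met by [k] itself, because all rows
    above it are skipped. As [k] is smaller than all of column [d.+1], it settles there. *)
Lemma pass_hit d k P P' o r :
  pass d k P = (P', o) ->
  (forall s, s \in P -> d.+1 < size s -> k < nth 0 s d.+1) ->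
  r \in P -> d < size r -> nth 0 r d <= k ->
  o = None \/ exists2 s, s \in P' & d.+1 < size s /\ nth 0 s d.+1 = k.
Proof.
elim: P P' o r => [|q P IH] P' o r //= E hP rP lt le.
case E1: (pass d k P) E => [P1 o1].
have hP1 s : s \in P -> d.+1 < size s -> k < nth 0 s d.+1.
  by move=> sP; apply: hP; rewrite inE sP orbT.
have [/hasP[s sP /andP[lts les]]|/hasPn no] :=
    boolP (has (fun s => (d < size s) && (nth 0 s d <= k)) P).
  have [->|[t tP ht]] := IH _ _ _ E1 hP1 sP lts les.
    by case=> _ <-; left.
  case: o1 E1 => [k1|] E1; last by case=> _ <-; left.
  case: ifP => _ [<- _]; right; exists t => //; rewrite inE tP orbT //.
rewrite pass_skip in E1; last first.
  by move=> s /no nh lts; move: nh; rewrite lts -ltnNge.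
have er : r = q.
  by case/predU1P: rP => // /no; rewrite lt le.
case: E1 => <- <-; subst q; rewrite /hit lt le /=.
case: eqP => [e|ne] /=; first by case=> _ <-; left.
rewrite hP ?mem_head //; last by lia.
case=> <- _; right; exists (set_nth 0 r d.+1 k); rewrite ?mem_head //.
by rewrite size_set_nth nth_set_nth /= eqxx; split=> //; lia.
Qed.

Lemma new_row_wf k P : wf P -> wf (new_row k P).
Proof.
case/andP=> /allP a; rewrite sorted_pairwise; last exact: leq_trans.
move=> s; apply/andP; split.
  apply/allP=> r; rewrite mem_cat inE !mem_filter.
  by case/or3P=> [/andP[_ /a]|/eqP->|/andP[_ /a]].
rewrite sorted_pairwise; last exact: leq_trans.
rewrite /new_row map_cat /= pairwise_cat /= allrel_consr.
rewrite !pairwise_map in s *.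
rewrite !(pairwise_filter _ s) ?andbT.
have h1 : all (fun x => x <= k) [seq head 0 i | i <- P & head 0 i < k].
  by rewrite all_map; apply/allP=> r /=; rewrite mem_filter => /andP[/ltnW].
have h2 : all (leq k) [seq head 0 i | i <- P & k <= head 0 i].
  by rewrite all_map; apply/allP=> r /=; rewrite mem_filter => /andP[].
rewrite h1 h2 !andbT /=; apply/allrelP => x y /(allP h1) xk /(allP h2).
exact: leq_trans.
Qed.

Lemma new_row_mem k P r : (r \in new_row k P) = (r == [:: k]) || (r \in P).
Proof.
rewrite mem_cat inE !mem_filter.
case: (r == _); rewrite ?orbT //=.
by case: (r \in P); rewrite ?andbF ?andbT //; case: (leqP k).
Qed.

Lemma passes_wf D k P : wf P -> wf (passes D k P).1.
Proof.
elim: D k P => [|D IH] k P wP /=; first exact: new_row_wf.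
case E: (pass D k P) => [P' [k'|]]; have := pass_wf E wP => // wP'.
exact: IH.
Qed.

Lemma passes_shrinks D k P r :
  r \in P -> exists2 s, s \in (passes D k P).1 & shrinks r s.
Proof.
elim: D k P r => [|D IH] k P r rP /=.
  by exists r; rewrite ?new_row_mem ?rP ?orbT //; apply: shrinks_refl.
case E: (pass D k P) => [P' o]; have [s sP [rs _]] := pass_shrinks E rP.
case: o E => [k'|] E; last by exists s.
have [t tP st] := IH k' P' s sP; exists t => //.
exact: shrinks_trans rs st.
Qed.

Lemma passes_sub D k P : {subset flatten (passes D k P).1 <= k :: flatten P}.
Proof.
elim: D k P => [|D IH] k P x /=.
  case/flattenP=> r; rewrite new_row_mem => /predU1P[->|rP xr].
    by rewrite !inE => ->.
  by rewrite inE; apply/orP; right; apply/flattenP; exists r.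
case E: (pass D k P) => [P' [k'|]]; have [h1 h2] := pass_sub E; last exact: h1.
by move/IH; rewrite inE => /predU1P[->|/h1].
Qed.

Lemma passes_col D k P : (passes D k P).2 <= D.
Proof.
elim: D k P => [|D IH] k P //=.
by case: (pass D k P) => P' [k'|] //=; apply: leq_trans (IH _ _) _.
Qed.

Lemma passes_skip e D k P :
  (forall r i, r \in P -> e <= i < size r -> k < nth 0 r i) ->
  e <= D -> passes D k P = passes e k P.
Proof.
move=> h; elim: D => [|D IH]; first by rewrite leqn0 => /eqP->.
rewrite leq_eqVlt => /predU1P[->//|leD] /=.
by rewrite pass_skip ?IH // => r rP lt; apply: h => //; rewrite lt andbT.
Qed.

Lemma size_le_width P r : r \in P -> size r <= width P.
Proof.
rewrite /width; elim: P => //= q P IH; rewrite inE leq_max.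
by case/predU1P=> [->|/IH->]; rewrite ?leqnn ?orbT.
Qed.

(** As rows weakly increase, the bound in column [e] holds in all columns to its right, where every
    pass is then idle. If [e] exceeds the width, the additional passes meet no cells. *)
Lemma insertion_skip e k P : wf P ->
  (forall r, r \in P -> e < size r -> k < nth 0 r e) ->
  insertion k P = passes e k P.
Proof.
move=> wP h; rewrite insertion_passes.
have h' r i : r \in P -> e <= i < size r -> k < nth 0 r i.
  move=> rP /andP[ei isz]; have [_ sr] := wf_row wP rP.
  have esz := leq_ltn_trans ei isz; apply: leq_trans (h r rP esz) _.
  exact: (sorted_leq_nth leq_trans leqnn).
case: (leqP e (width P)) => [|lt]; first exact: passes_skip.
rewrite -(@passes_skip (width P) e) // ?(ltnW lt) // => r i rP.
case/andP=> wi; rewrite ltnNge => /negP[]; exact: leq_trans (size_le_width rP) wi.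
Qed.

(** * Inserting one row *)

Definition run (P : tableau) (w : seq nat) : tableau :=
  foldl (fun P x => (insertion x P).1) P w.

Fixpoint cols (P : tableau) (w : seq nat) : seq nat :=
  if w is x :: w' then (insertion x P).2 :: cols (insertion x P).1 w' else [::].

Lemma run_cat P w1 w2 : run P (w1 ++ w2) = run (run P w1) w2.
Proof. exact: foldl_cat. Qed.

Lemma cols_cat P w1 w2 : cols P (w1 ++ w2) = cols P w1 ++ cols (run P w1) w2.
Proof. by elim: w1 P => //= x w1 IH P; rewrite IH. Qed.

Lemma size_cols P w : size (cols P w) = size w.
Proof. by elim: w P => //= x w IH P; rewrite IH. Qed.

Lemma run_wf P w : wf P -> wf (run P w).
Proof.
elim: w P => //= x w IH P wP; apply: IH.
by rewrite insertion_passes; apply: passes_wf.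
Qed.

Lemma insertion_shrinks x P r :
  r \in P -> exists2 s, s \in (insertion x P).1 & shrinks r s.
Proof. by rewrite insertion_passes; apply: passes_shrinks. Qed.

Lemma run_sub P w : {subset flatten (run P w) <= flatten P ++ w}.
Proof.
elim: w P => [|x w IH] P y /=; first by rewrite cats0.
move/IH; rewrite insertion_passes !mem_cat inE => /orP[/passes_sub|->].
  by rewrite inE => /orP[->|->]; rewrite ?orbT.
by rewrite !orbT.
Qed.

Lemma new_row_bottom x P : wf P -> (forall r, r \in P -> x < nth 0 r 0) ->
  new_row x P = [:: x] :: P.
Proof.
move=> wP h; rewrite /new_row.
rewrite (eq_in_filter (a2 := pred0)) ?filter_pred0 /=; last first.
  by move=> r /h; rewrite nth0 => /ltnW; rewrite leqNgt => /negbTE.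
rewrite (eq_in_filter (a2 := predT)) ?filter_predT //.
by move=> r /h; rewrite nth0 => /ltnW ->.
Qed.

Lemma insertion_bottom x P : wf P -> (forall r, r \in P -> x < nth 0 r 0) ->
  insertion x P = ([:: x] :: P, 0).
Proof.
move=> wP h; rewrite (@insertion_skip 0) //= ?new_row_bottom // => r rP _.
exact: h.
Qed.

(* By induction from the last letter: if some entry of column [e] were at most
   [x], the topmost one would let [x] enter column [e.+1], whose entries must all
   exceed the next letter. *)
Lemma column_bound m e rho P :
  wf P -> sorted ltn rho -> m = e + size rho ->
  cols P rho = iota e (size rho) ->
  (forall r, r \in run P rho -> size r <= m) ->
  forall i r, i < size rho -> r \in P -> e + i < size r ->
    nth 0 rho i < nth 0 r (e + i).
Proof.
elim: rho e P => [|x rho IH] e P // wP srt em /= [ec ecs] sz i r.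
set S := (insertion x P).1 in ecs sz.
have wS : wf S by rewrite /S insertion_passes passes_wf.
have {}IH := IH e.+1 S wS (path_sorted srt) _ ecs sz.
have {}IH := IH (etrans em (addnS _ _)).
have hS s : s \in S -> e.+1 < size s -> x < nth 0 s e.+1.
  case: rho srt em {ecs} sz IH => [|y rho] /= srt em sz IH sS lt.
    by move: (sz s sS); rewrite em /= addn1 leqNgt lt.
  have /andP[xy _] := srt.
  have := IH 0 s isT sS; rewrite addn0 => /(_ lt) /=.
  exact: ltn_trans.
have hP s : s \in P -> e.+1 < size s -> x < nth 0 s e.+1.
  move=> sP lt; have [t tS [st ht]] := insertion_shrinks x sP.
  exact: leq_trans (hS t tS (leq_trans lt st)) (ht _ lt).
case: i => [|i] /= lti rP.
  rewrite addn0 => lt; case: ltnP => // le.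
  have := insertion_skip wP hP; rewrite /=.
  case E: (pass e x P) => [P1 o] Ei.
  have [eo|[s sP1 [lts es]]] := pass_hit E hP rP lt le.
    by move: ec; rewrite Ei eo /= => /eqP; rewrite gtn_eqF.
  have [t tS [st ht]] : exists2 t, t \in S & shrinks s t.
    rewrite /S Ei; case: (o) => [k'|]; first exact: passes_shrinks.
    by exists s => //; apply: shrinks_refl.
  have := hS t tS (leq_trans lts st).
  by rewrite ltnNge -{1}es ht.
rewrite addnS -addSn => lt.
have [t tS [st ht]] := insertion_shrinks x rP.
apply: leq_trans (ht _ lt); apply: IH => //.
exact: leq_trans st.
Qed.

(* Of two parts, [a] the lower: pairwise, the parts larger than 1 weakly decrease
   from bottom to top, while the ones are anywhere. *)
Definition part_rel (a b : nat) : bool := (a <= 1) || (b <= a).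

(** The topmost row with an entry at most [x] in column [d] receives [x]. It is again shorter than
    [m]: by [part_rel] a row above [r] is no longer than [r], unless [r] is a singleton, and a
    singleton would have stopped the letter. *)
Lemma pass_short d x m P P' k' r :
  pass d x P = (P', Some k') ->
  (forall s, s \in P -> d.+1 < size s -> x < nth 0 s d.+1) ->
  pairwise part_rel (shape P) ->
  r \in P -> size r < m -> d < size r -> nth 0 r d <= x ->
  exists s, [/\ s \in P', size s < m, d.+1 < size s & nth 0 s d.+1 = x].
Proof.
elim: P P' k' r => [|q P IH] P' k' r //= E hP /andP[/allP al pw] rP rm lt le.
case E1: (pass d x P) E => [P1 [k1|]] // E.
have hP1 s : s \in P -> d.+1 < size s -> x < nth 0 s d.+1.
  by move=> sP; apply: hP; rewrite inE sP orbT.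
have [/hasP[s sP /andP[lts les]]|/hasPn no] :=
    boolP (has (fun s => (d < size s) && (nth 0 s d <= x)) P).
  have ext s0 : s0 \in P -> size s0 < m -> d < size s0 -> nth 0 s0 d <= x ->
      exists s, [/\ s \in P', size s < m, d.+1 < size s & nth 0 s d.+1 = x].
    move=> s0P s0m lt0 le0.
    have [t [tP ht1 ht2 ht3]] := IH _ _ _ E1 hP1 pw s0P s0m lt0 le0.
    exists t; split=> //; move: E; case: ifP => _ [<- _]; by rewrite inE tP orbT.
  case/predU1P: rP => [er|rP]; last exact: (ext r).
  subst q; apply: (ext s) => //.
  have := al _ (map_f size sP); rewrite /part_rel => /orP[r1|]; last first.
    by move=> sr; apply: leq_ltn_trans rm.
  exfalso; have d0 : size r = d.+1 by apply/eqP; rewrite eqn_leq lt (leq_trans r1).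
  have := pass_nostop (P := r :: P) (d := d) (k := x) (P' := P') (k' := k') (r := r).
  by rewrite /= E1 mem_head => /(_ E isT d0); rewrite ltnNge le.
have er : r = q.
  by case/predU1P: rP => // /no; rewrite lt le.
subst q.
rewrite pass_skip in E1; last first.
  by move=> s /no nh lts; move: nh; rewrite lts -ltnNge.
case: E1 E => <- <-; rewrite /hit lt le /=.
case: eqP => [e|ne] //=.
have lt2 : d.+1 < size r by rewrite ltn_neqAle lt andbT; apply/eqP => e; apply: ne.
rewrite hP ?mem_head // => -[<- _].
exists (set_nth 0 r d.+1 x); rewrite ?mem_head //.
rewrite size_set_nth nth_set_nth /= eqxx; split=> //; lia.
Qed.

(* [b] is the unfinished bottom row. As in [column_bound], a letter entering a row
   shorter than [m] would pull the next ones into a short row as well, until one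
   of them lengthens such a row instead of [b]. *)
Lemma short_bound m beta e rho b Q :
  0 < e -> wf (b :: Q) -> size b <= e -> sorted ltn rho -> m = e + size rho ->
  cols (b :: Q) rho = iota e (size rho) ->
  shape (run (b :: Q) rho) = m :: beta ->
  pairwise part_rel beta -> all (leq^~ m) beta ->
  shape Q = beta /\ size b = e /\
  forall i r, i < size rho -> r \in Q -> size r < m -> e.-1 + i < size r ->
    nth 0 rho i < nth 0 r (e.-1 + i).
Proof.
elim: rho e b Q => [|x rho IH] [|d] b Q // _ wS sb srt em /=.
  by move=> _ [-> ->] _ _; rewrite em addn0.
move=> hc hs pw bm.
have szm r : r \in run (b :: Q) (x :: rho) -> size r <= m.
  move/(map_f size); rewrite -/(shape _) /= hs inE => /predU1P[->//|].
  by move/(allP bm).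
have := column_bound wS srt em hc szm.
move/(_ 0 _ isT); rewrite addn0 /= => cb.
have := insertion_skip wS cb; move: hc hs {szm}.
set S := insertion x (b :: Q) => -[ec ecs] hs.
have wS' : wf S.1 by rewrite /S insertion_passes passes_wf.
move=> /=.
case E: (pass d x Q) => [Q1 [k1|]] ES; last first.
  rewrite ES /= in ecs hs wS'.
  have := IH d.+2 b Q1 isT wS' (leq_trans sb (leqnSn _)) (path_sorted srt)
     (etrans em (addnS _ _)) ecs hs pw bm.
  by case=> _ [e1]; rewrite e1 ltnn in sb.
move: ES; case: ifP => [hb|_] ES; last first.
  by have := passes_col d k1 (b :: Q1); rewrite -ES ec ltnn.
move: ES; case: eqP => [eb|nb] ES; last first.
  by have := passes_col d (nth 0 b d.+1) (set_nth 0 b d.+1 k1 :: Q1); rewrite -ES ec ltnn.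
rewrite ES /= in ecs hs wS'.
have sb' : size (set_nth 0 b d.+1 k1) <= d.+2 by rewrite size_set_nth eb; lia.
have [sQ1 [_ h]] := IH d.+2 _ Q1 isT wS' sb' (path_sorted srt)
     (etrans em (addnS _ _)) ecs hs pw bm.
have sQ : shape Q = beta by rewrite -sQ1 (pass_shape E).
split=> //; split=> // -[|i] r /= lti rQ rm.
  rewrite addn0 => lt; case: ltnP => // le.
  have hQ s : s \in Q -> d.+1 < size s -> x < nth 0 s d.+1.
    by move=> sQ'; apply: cb; rewrite inE sQ' orbT.
  have pwQ : pairwise part_rel (shape Q) by rewrite sQ.
  have [s [sP sm lts es]] := pass_short E hQ pwQ rQ rm lt le.
  case: rho {IH ecs hs cb lti} srt em h => [|y rho] /= srt em h.
    by move: sm; rewrite em addn1 ltnS leqNgt lts.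
  have /andP[xy _] := srt.
  have := h 0 s isT sP sm; rewrite addn0 es => /(_ lts) /=.
  by rewrite ltnNge (ltnW xy).
rewrite addnS -addSn => lt.
have [t tQ [[st ht] es]] := pass_shrinks E rQ.
apply: leq_trans (ht _ lt); apply: h => //; first by rewrite es.
exact: leq_trans st.
Qed.

(** Follows the bottom row through an insertion that ends by creating a row: its length and head
    persist, the released letter is at least [x], and a singleton bottom row must have repelled the
    letter. *)
Lemma passes_col0 D x r P P' :
  passes D x (r :: P) = (P', 0) ->
  exists k' r' P1, [/\ P' = new_row k' (r' :: P1), x <= k', size r' = size r,
    head 0 r' = head 0 r & 0 < D -> size r = 1 -> x < head 0 r].
Proof.
elim: D x r P => [|D IH] x r P; first by case=> <-; exists x, r, P.
have -> : passes D.+1 x (r :: P) = let: (P1, o) := pass D x (r :: P) in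
  if o is Some k' then passes D k' P1 else (P1, D.+1) by [].
case E: (pass D x (r :: P)) => [Q [k1|]] //.
have sQ := pass_shape E; have hQ := pass_heads E.
have xk := pass_le E.
have ns := pass_nostop E (mem_head r P).
case: Q {E} sQ hQ => [|r1 P1] //= [sr sP] [hr _].
move=> /[dup] E /IH [k' [r' [P2 [-> le sr' hr' lt]]]].
exists k', r', P2; rewrite sr' sr hr' hr (leq_trans xk le); split=> // _ r1'.
(* A row of length 1 can stop a letter only in the pass at column 0, which is the last pass. *)
case: D {IH E} ns lt => [|D] ns lt; first by rewrite -nth0 ns.
by rewrite -hr; apply: leq_ltn_trans xk (lt _ _); rewrite ?sr.
Qed.

Lemma wf_head r P s : wf (r :: P) -> s \in P -> head 0 r <= head 0 s.
Proof.
case/andP=> _ /=; rewrite (path_sortedE leq_trans) => /andP[/allP h _] sP.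
exact/h/map_f.
Qed.

(* Otherwise the new row lies above the bottom row of [P], which therefore has
   length 1 and would have been extended. *)
Lemma singleton_bound x P beta :
  wf P -> x \notin flatten P -> (insertion x P).2 = 0 ->
  shape (insertion x P).1 = 1 :: beta ->
  forall r, r \in P -> x < nth 0 r 0.
Proof.
case: P => [|r P] // wP xP.
rewrite insertion_passes.
have [szr _] := wf_row wP (mem_head r P).
have D0 : 0 < width (r :: P) by apply: leq_trans (size_le_width (mem_head r P)).
case E: (passes _ _ _) => [P' c] /= c0 sP'; subst c.
have [k' [r' [P1 [e xk sr hr lt]]]] := passes_col0 E.
have xr : x < head 0 r.
  case: (ltngtP x (head 0 r)) => // [gt|ex].
    have hk : head 0 r' < k' by rewrite hr; apply: leq_trans xk.
    move: sP'; rewrite e /new_row /= hk /= => -[s1 _].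
    by move: (lt D0); rewrite -sr s1 ltnNge (ltnW gt) => /(_ erefl).
  by move: xP; rewrite ex /= mem_cat -nth0 mem_nth.
move=> s; rewrite inE nth0 => /predU1P[->//|sP].
by apply: leq_trans xr _; apply: wf_head sP.
Qed.

(** * Necessary and sufficient conditions for a row to be inserted as a new bottom row *)

Definition tight (r s : seq nat) : bool :=
  all (fun i => ((i < size r) ==> (nth 0 r i < nth 0 s i)) &&
    ((size s < size r) ==> (nth 0 r i.+1 < nth 0 s i))) (iota 0 (size s)).

Lemma tightP r s : reflect (forall i, i < size s ->
    (i < size r -> nth 0 r i < nth 0 s i) /\
    (size s < size r -> nth 0 r i.+1 < nth 0 s i)) (tight r s).
Proof.
apply: (iffP allP) => h i; last first.
  by rewrite mem_iota => /h [h1 h2]; apply/andP; split; apply/implyP.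
move=> lt; have /h : i \in iota 0 (size s) by rewrite mem_iota.
by case/andP=> /implyP h1 /implyP h2.
Qed.

Lemma stage_necessary P rho beta :
  wf P -> 0 < size rho -> sorted ltn rho ->
  (forall x, x \in rho -> x \notin flatten P) ->
  pairwise part_rel (size rho :: beta) ->
  cols P rho = iota 0 (size rho) -> shape (run P rho) = size rho :: beta ->
  shape P = beta /\ all (tight rho) P.
Proof.
case: rho => [|x rho] // wP _ srt fresh /andP[bm pw] hc hs.
have hx r : r \in P -> x < nth 0 r 0.
  (* A new row of length 1 may lie below longer rows, where [column_bound] does not apply; from
     length 2 on, [part_rel] bounds all the parts above. *)
  case: rho srt fresh bm hc hs => [|y rho] srt fresh bm hc hs.
    by apply: (singleton_bound wP (fresh x (mem_head _ _)) _ hs); case: hc.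
  have szm s : s \in run P (x :: y :: rho) -> size s <= (size rho).+2.
    by move/(map_f size); rewrite -/(shape _) hs inE => /predU1P[->//|/(allP bm)].
  move=> rP; apply: (column_bound wP srt erefl hc szm (i := 0)) => //.
  by have [] := wf_row wP rP.
have eb := insertion_bottom wP hx.
have hS : wf ([:: x] :: P).
  by have := passes_wf (width P) x wP; rewrite -insertion_passes eb.
case: rho srt fresh bm hc hs => [|y rho] srt fresh bm hc hs.
  move: hs; rewrite /= eb /= => -[<-]; split=> //; apply/allP=> r rP.
  apply/tightP => i lt; split=> [|/= lt2]; last first.
    by case: (r) lt lt2.
  by case: i lt => //= _ _; apply: hx.
have bm' : all (leq^~ (size (x :: y :: rho))) beta.
  by apply: sub_all bm => b.
have szm s : s \in run P (x :: y :: rho) -> size s <= (size rho).+2.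
  by move/(map_f size); rewrite -/(shape _) hs inE => /predU1P[->//|/(allP bm')].
have cb := column_bound wP srt erefl hc szm.
have hc1 : cols ([:: x] :: P) (y :: rho) = iota 1 (size (y :: rho)).
  by move: hc; rewrite /= eb /= => -[-> ->].
have hs1 : shape (run ([:: x] :: P) (y :: rho)) = (size rho).+2 :: beta.
  by move: hs; rewrite /= eb.
(* Here [e = 1] and the first letter is already in place, so letter [i.+1] of the row is compared
   with column [i] of the shorter rows: the second inequality of [tight]. *)
have [sP [_ h]] := short_bound (ltn0Sn 0) hS (leqnn _) (path_sorted srt)
  erefl hc1 hs1 pw bm'.
split=> //; apply/allP=> r rP; apply/tightP => i lt; split=> [lti|lti].
  exact: cb.
by apply: (h i r _ rP lti lt); move: lti => /= lti; lia.
Qed.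

(* The column contents of the rows of each length: all that survives of a tableau
   [T] in its insertion tableau. *)
Definition triple (T : tableau) (q i v : nat) : bool :=
  has (fun r => [&& size r == q, i < q & nth 0 r i == v]) T.

Definition same_triples (T T' : tableau) : Prop :=
  forall q i v, triple T q i v = triple T' q i v.

Lemma triple_cons r T q i v :
  triple (r :: T) q i v = [&& size r == q, i < q & nth 0 r i == v] || triple T q i v.
Proof. by []. Qed.

Lemma triple_mem T r i : r \in T -> i < size r -> triple T (size r) i (nth 0 r i).
Proof. by move=> rT lt; apply/hasP; exists r; rewrite // lt !eqxx. Qed.

(** [tight r] sees a row above only through its length and one entry at a time. Hence tightness can
    be transferred between a tableau and its insertion tableau. *)
Lemma all_tight r T : reflect (forall q i v, triple T q i v ->
    (i < size r -> nth 0 r i < v) /\ (q < size r -> nth 0 r i.+1 < v))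
  (all (tight r) T).
Proof.
apply: (iffP allP) => [h q i v /hasP[s sT /and3P[/eqP <- lt /eqP <-]]|h s sT].
  exact: (tightP _ _ (h s sT)).
by apply/tightP => i lt; apply: h; apply: triple_mem.
Qed.

Lemma eq_all_tight r T T' : same_triples T T' -> all (tight r) T -> all (tight r) T'.
Proof. by move=> e /all_tight h; apply/all_tight => q i v; rewrite -e; apply: h. Qed.

Lemma wf_behead r P : wf (r :: P) -> wf P.
Proof. by case/andP=> /= /andP[_ a] /path_sorted s; apply/andP. Qed.

(** Only rows of length [m] are hit, and their entries in column [d.+1] together gain [x] and give
    up the released letter [k]. Contents are compared as sets, so [k] is added on one side and [x]
    on the other instead of removing anything. *)
Lemma pass_block d x m Q :
  wf Q -> pairwise part_rel (shape Q) -> all (leq^~ m) (shape Q) -> d.+1 < m ->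
  (forall r, r \in Q -> size r < m -> d < size r -> x < nth 0 r d) ->
  exists Q1 k, [/\ pass d x Q = (Q1, Some k),
    k = x \/ (exists2 r, r \in Q & size r = m /\ nth 0 r d <= x) &
    forall q i v,
      triple Q1 q i v || [&& q == m, i == d.+1 & v == k] =
      triple Q q i v || [&& q == m, i == d.+1 & v == x]].
Proof.
move=> + + + ltm; elim: Q => [|r Q IH] wQ /= pw am short.
  by exists [::], x; split=> //; left.
have wQ' := wf_behead wQ.
case/andP: pw => rel pw; case/andP: am => rm am.
have [Q1 [k [E hk hT]]] := IH wQ' pw am
  (fun s sQ => short s (@mem_behead _ (r :: Q) s sQ)).
rewrite E; case: ifP => [h|_]; last first.
  exists (r :: Q1), k; split=> // [|q i v]; last by rewrite /= -!orbA hT.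
  case: hk => [->|[s sQ hs]]; [by left | right; exists s => //].
  by rewrite inE sQ orbT.
have [lt le _] := and3P h.
have sr : size r = m.
  apply/eqP; rewrite eqn_leq rm leqNgt; apply/negP => rltm.
  have hx := short r (mem_head _ _) rltm lt.
  case: hk => [ek|[s sQ [sm hs]]].
    by move: le; rewrite ek leqNgt hx.
  (* A shorter row below the row [s] of length [m] is a singleton, so [d] is 0; its head is at most
     that of [s], hence at most [x], against [short]. *)
  have := allP rel _ (map_f size sQ); rewrite /part_rel sm [m <= _]leqNgt rltm orbF.
  move=> r1; have d0 : d = 0 by apply/eqP; rewrite -leqn0 -ltnS (leq_trans lt).
  subst d; move: hx hs; rewrite !nth0 => hx hs.
  by have := leq_trans hx (leq_trans (wf_head wQ sQ) hs); rewrite ltnn.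
have -> : (size r == d.+1) = false by rewrite sr gtn_eqF.
exists (set_nth 0 r d.+1 k :: Q1), (nth 0 r d.+1); split=> // [|q i v].
  case: hk => [ek|[s sQ hs]]; right; last by exists s; rewrite // inE sQ orbT.
  by exists r; rewrite ?mem_head // -ek.
have sr' : size (set_nth 0 r d.+1 k) = m.
  by rewrite size_set_nth sr; apply/maxn_idPr.
rewrite /= sr sr' nth_set_nth /=; move: (hT q i v).
case: (eqVneq m q) => [<-|_] /=; last by [].
case: (i =P d.+1) => [->|_] /=; last by rewrite !orbF => ->.
rewrite ltm /= (eq_sym k v) (eq_sym (nth 0 r d.+1)).
by case: (v == k); case: (v == x); case: (v == _); do 2?case: (triple _ _ _ _).
Qed.

(* The letter [k2] released by a pass can follow, in the bottom row, the letter
   [k1] released by the previous pass one column to the left. *)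
Lemma pass_pass d x y R R1 k1 R2 k2 :
  all (sorted leq) R -> x <= y ->
  pass d x R = (R1, Some k1) -> pass d.+1 y R1 = (R2, Some k2) -> k1 <= k2.
Proof.
move=> + xy; elim: R R1 k1 R2 k2 => [|r R IH] R1 k1 R2 k2 /=.
  by move=> _ [<- <-] [_ <-].
case/andP=> sr sR.
case E: (pass d x R) => [Q [k|]] //.
case: ifP => [/and3P[lt le h]|_].
  case: eqP h => [//|ne] /= h [<- <-] /=.
  case E2: (pass d.+1 y Q) => [Q2 [k'|]] //.
  have kk := IH _ _ _ _ sR E E2.
  have sz : size (set_nth 0 r d.+1 k) = size r.
    rewrite size_set_nth; apply/maxn_idPr; rewrite ltn_neqAle lt andbT.
    by apply/eqP => e; apply: ne.
  rewrite /hit sz !nth_set_nth /= eqxx (gtn_eqF (ltnSn _)) kk.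
  have -> : d.+1 < size r by rewrite -sz size_set_nth leq_maxl.
  case: (eqVneq (size r) d.+2) => //= ne2.
  have lt2 : d.+2 < size r.
    by rewrite ltn_neqAle eq_sym ne2 -sz size_set_nth leq_maxl.
  have mono : nth 0 r d.+1 <= nth 0 r d.+2.
    by apply: (sorted_leq_nth leq_trans leqnn 0 sr); rewrite ?inE // ltnW.
  case: ltnP => [_ [_ <-] //|ge [_ <-]]; exact: leq_trans ge.
move=> [<- <-] /=.
case E2: (pass d.+1 y Q) => [Q2 [k'|]] //.
have kk := IH _ _ _ _ sR E E2.
case: ifP => [/and3P[_ _ h]|_]; last by case=> _ <-.
case: eqP h => //= _ h [_ <-]; exact: leq_trans (ltnW h).
Qed.

Lemma wf_rows P : wf P -> all (sorted leq) P.
Proof. by case/andP=> /allP h _; apply/allP=> r /h /andP[]. Qed.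

Lemma stage_sufficient P rho :
  wf P -> 0 < size rho -> sorted ltn rho ->
  pairwise part_rel (size rho :: shape P) -> all (tight rho) P ->
  [/\ cols P rho = iota 0 (size rho),
    shape (run P rho) = size rho :: shape P &
    same_triples (run P rho) (rho :: P)].
Proof.
move=> wP rho0 srt /= /andP[rel pw] /all_tight dom.
set m := size rho.
(* Invariant after [e] letters. The unfinished bottom row [b] and the rows of length [m] may have
   exchanged entries, but only within a column. The last clause says that the letter released by the
   next pass fits behind the last cell of [b]; [pass_pass] renews it. *)
suff H e : 0 < e <= m -> exists b Q, [/\ run P (take e rho) = b :: Q,
    cols P (take e rho) = iota 0 e, size b = e /\ shape Q = shape P,
    forall q i v, triple Q q i v || [&& q == m, i < e & nth 0 b i == v] =
      triple P q i v || [&& q == m, i < e & nth 0 rho i == v] &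
    forall y Q2 k2, nth 0 rho e.-1 <= y -> pass e.-1 y Q = (Q2, Some k2) ->
      nth 0 b e.-1 <= k2].
  have [|b [Q [hr hc [sb sQ] hT _]]] := H m; first by rewrite rho0 leqnn.
  rewrite take_size in hr hc.
  split=> // [|q i v]; first by rewrite hr /= sb sQ.
  have := hT q i v; rewrite hr !triple_cons sb -/m (eq_sym m q).
  by rewrite orbC [in X in _ = X -> _]orbC; case: (q =P m) => [->|].
elim: e => [//|[_ _|e IH lem]].
  exists [:: nth 0 rho 0], P.
  have hx r : r \in P -> nth 0 rho 0 < nth 0 r 0.
    move=> rP; have [r0 _] := wf_row wP rP.
    by have [/(_ rho0)] := dom _ _ _ (triple_mem rP r0).
  have -> : take 1 rho = [:: nth 0 rho 0].
    by case: (rho) rho0 => //= a ? _; rewrite take0.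
  rewrite /= (insertion_bottom wP hx); split=> //.
    by move=> q [|i] v; rewrite ?andbF.
  by move=> y Q2 k2 le /pass_le; apply: leq_trans.
have [|b [Q [hr hc [sb sQ] hT hk]]] := IH; first exact: ltnW.
set x := nth 0 rho e.+1.
have tk : take e.+2 rho = take e.+1 rho ++ [:: x].
  by rewrite (take_nth 0) // -cats1.
have wS : wf (b :: Q) by rewrite -hr run_wf.
have wQ := wf_behead wS.
have am : all (leq^~ m) (shape Q).
  rewrite sQ; apply: sub_all rel => a; rewrite /part_rel -/m.
  by case/orP=> // le; have := leq_trans lem le.
(* The exchanges have not reached column [e.+1], and never touch shorter rows, so the triple
   equation brings the bounds of [dom] from [P] to [Q]. *)
have hb r : r \in b :: Q -> e.+1 < size r -> x < nth 0 r e.+1.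
  rewrite inE => /predU1P[->|rQ lt]; first by rewrite sb ltnn.
  have := hT (size r) e.+1 (nth 0 r e.+1).
  rewrite ltnn !andbF !orbF triple_mem // => /esym /dom [h _].
  exact: h.
have short r : r \in Q -> size r < m -> e < size r -> x < nth 0 r e.
  move=> rQ rm lt; have := hT (size r) e (nth 0 r e).
  by rewrite (ltn_eqF rm) /= !orbF triple_mem // => /esym /dom [_ /(_ rm)].
have pwQ : pairwise part_rel (shape Q) by rewrite sQ.
have [Q1 [k [E _ hT1]]] := pass_block wQ pwQ am lem short.
have kb : nth 0 b e <= k.
  apply: hk E; rewrite /x /=; apply: ltnW.
  by apply: (sorted_ltn_nth ltn_trans 0 srt); rewrite ?inE // ltnW.
have ins : insertion x (b :: Q) = (set_nth 0 b e.+1 k :: Q1, e.+1).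
  by rewrite (insertion_skip wS hb) /= E /hit sb ltnSn kb eqxx.
exists (set_nth 0 b e.+1 k), Q1.
have iot : iota 0 e.+2 = iota 0 e.+1 ++ [:: e.+1] by rewrite -[e.+2]addn1 iotaD.
rewrite tk run_cat cols_cat iot hr hc /= ins.
split=> //.
- by rewrite (pass_shape E) sQ size_set_nth sb; split=> //; apply/maxn_idPl.
- move=> q i v; rewrite nth_set_nth /=.
  move: (hT q i v) (hT1 q i v); rewrite -/m.
  case: (q == m) => /=; last by rewrite !orbF => -> ->.
  rewrite (ltnS i e.+1) [i <= _]leq_eqVlt.
  case: (i =P e.+1) => [->|_] /=; last by rewrite !orbF => h1 ->.
  by rewrite ltnn !orbF -/x !(eq_sym v) => -> ->.
move=> y Q2 k2 le E2; rewrite nth_set_nth /= eqxx.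
exact: pass_pass (wf_rows wQ) le E E2.
Qed.

(** * Inserting all rows, from top to bottom *)

Definition word (T : tableau) : seq nat := flatten (rev T).

(** The columns of the successive new cells when the rows of a diagram of shape [a] are filled one
    after the other, the top row first. *)
Definition colseq (a : seq nat) : seq nat := flatten [seq iota 0 m | m <- rev a].

Lemma word_cons r T : word (r :: T) = word T ++ r.
Proof. by rewrite /word rev_cons -cats1 flatten_cat /= cats0. Qed.

Lemma colseq_cons m a : colseq (m :: a) = colseq a ++ iota 0 m.
Proof. by rewrite /colseq rev_cons -cats1 map_cat flatten_cat /= cats0. Qed.

Lemma size_colseq a : size (colseq a) = sumn a.
Proof.
by elim: a => //= m a IH; rewrite colseq_cons size_cat IH size_iota addnC.
Qed.

Lemma size_word T : size (word T) = sumn (shape T).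
Proof. by elim: T => //= r T IH; rewrite word_cons size_cat IH addnC. Qed.

Lemma mem_word T : word T =i flatten T.
Proof.
by elim: T => //= r T IH x; rewrite word_cons !mem_cat IH orbC.
Qed.

(** Induction on the rows, the bottom row being inserted last. The stage lemmas yield tightness of
    [r] over the insertion tableau of the rows above; the statement on triples is proved along with
    the equivalence in order to replace that tableau by [T]. *)
Lemma run_word_tight T :
  all (fun r => (0 < size r) && sorted ltn r) T -> uniq (flatten T) ->
  pairwise part_rel (shape T) ->
  (shape (run [::] (word T)) = shape T /\
    cols [::] (word T) = colseq (shape T) <-> pairwise tight T) /\
  (pairwise tight T -> same_triples (run [::] (word T)) T).
Proof.
elim: T => [|r T IH] //= /andP[/andP[r0 srt] aT] uT pw.
have uT' : uniq (flatten T) by move: uT; rewrite cat_uniq => /and3P[].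
have fresh x : x \in r -> x \notin flatten (run [::] (word T)).
  move=> xr; apply/negP => /run_sub; rewrite mem_cat /= mem_word => xT.
  move: uT; rewrite cat_uniq => /and3P[_ /hasPn /(_ x xT)] /=.
  by rewrite xr.
have [IH1 IH2] := IH aT uT' (proj2 (andP pw)).
have wP : wf (run [::] (word T)) by apply: run_wf.
rewrite word_cons colseq_cons run_cat cols_cat.
have suf : pairwise tight (r :: T) ->
   [/\ shape (run [::] (word T)) = shape T, cols [::] (word T) = colseq (shape T) &
   [/\ cols (run [::] (word T)) r = iota 0 (size r),
    shape (run (run [::] (word T)) r) = size r :: shape (run [::] (word T)) &
    same_triples (run (run [::] (word T)) r) (r :: run [::] (word T))]].
  move=> /= /andP[dr dT]; have [sP cP] := (proj2 IH1) dT.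
  split=> //; apply: stage_sufficient => //; first by rewrite sP.
  by apply: eq_all_tight dr => q i v; rewrite (IH2 dT).
split; last first.
  move=> dT; have [_ _ [_ _ h]] := suf dT; move=> q i v; rewrite h /=.
  by rewrite (IH2 (proj2 (andP dT))).
split=> [[hs /eqP]|dT]; last first.
  by have [h1 h2 [h3 h4 _]] := suf dT; rewrite h4 h3 h2 h1.
rewrite eqseq_cat => [/andP[/eqP hc1 /eqP hc2]|]; last first.
  by rewrite size_cols size_colseq size_word.
have [sP dom] := stage_necessary wP r0 srt fresh pw hc2 hs.
have dT : pairwise tight T by apply/(proj1 IH1).
by rewrite dT andbT; apply: eq_all_tight dom => q i v; rewrite IH2.
Qed.

(** * The recording tableau *)

Definition record_step (Q : tableau) (kd : nat * nat) : tableau :=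
  if kd.2 is 0 then new_row kd.1 Q else append_topmost kd.2 kd.1 Q.

Definition record (ds : seq nat) : tableau :=
  foldl record_step [::] (zip (iota 1 (size ds)) ds).

Lemma PQ_hatE w : PQ_hat w = (run [::] w, record (cols [::] w)).
Proof.
rewrite /PQ_hat /record size_cols.
suff H s P Q : foldl PQ_step (P, Q) (zip (iota s (size w)) w) =
    (run P w, foldl record_step Q (zip (iota s (size w)) (cols P w))) by [].
elim: w s P Q => //= x w IH s P Q.
rewrite {2}/PQ_step /=; case: (insertion x P) => P' d /=.
by rewrite IH.
Qed.

Lemma iota_rcons s m : iota s m.+1 = rcons (iota s m) (s + m).
Proof. by rewrite -[m.+1]addn1 iotaD cats1. Qed.

Lemma record_rcons ds d :
  record (rcons ds d) = record_step (record ds) ((size ds).+1, d).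
Proof.
rewrite /record size_rcons iota_rcons add1n zip_rcons ?size_iota //.
by rewrite foldl_rcons.
Qed.

Lemma append_topmost_mem d k Q r : r \in append_topmost d k Q ->
  r \in Q \/ exists2 s, s \in Q & size s = d /\ r = rcons s k.
Proof.
elim: Q => //= q Q IH; case: ifP => _.
  rewrite inE => /predU1P[->|/IH [rQ|[s sQ hs]]]; first by left; rewrite mem_head.
    by left; rewrite inE rQ orbT.
  by right; exists s; rewrite // inE sQ orbT.
case: eqP => [e|_]; last by left.
rewrite inE => /predU1P[->|rQ]; first by right; exists q; rewrite ?mem_head.
by left; rewrite inE rQ orbT.
Qed.

(** An entry in column [i] is a step that created a cell in column [i], so the recording tableau
    determines [ds] at every step it contains. Steps are counted from 1, whence the predecessor. *)
Lemma record_col ds r i : r \in record ds -> i < size r ->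
  0 < nth 0 r i <= size ds /\ nth 0 ds (nth 0 r i).-1 = i.
Proof.
elim/last_ind: ds r i => [//|ds d IH] r i; rewrite record_rcons size_rcons => rQ.
have old s j : s \in record ds -> j < size s ->
    0 < nth 0 s j <= (size ds).+1 /\ nth 0 (rcons ds d) (nth 0 s j).-1 = j.
  move=> sQ lt; have [/andP[h0 h1] e] := IH s j sQ lt.
  rewrite h0 (leqW h1) nth_rcons; split=> //.
  by rewrite prednK // h1.
have new : nth 0 (rcons ds d) (size ds) = d by rewrite nth_rcons ltnn eqxx.
move: rQ; rewrite /record_step /=; case: d old new => [|d] old new.
  rewrite new_row_mem => /predU1P[->|]; last exact: old.
  by case: i => //= _; rewrite new leqnn.
case/append_topmost_mem => [|[s sQ [sd ->]]]; first exact: old.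
rewrite size_rcons (nth_rcons 0 s) ltnS leq_eqVlt => /predU1P[->|lt]; last first.
  by rewrite lt; apply: old.
by rewrite ltnn eqxx /= new sd leqnn.
Qed.

Lemma append_topmost_rcons d k Q r :
  size r = d -> append_topmost d k (rcons Q r) = rcons Q (rcons r k).
Proof.
move=> <-; elim: Q => [|q Q IH] /=; first by rewrite eqxx.
by rewrite -cats1 /shape map_cat mem_cat /= mem_head orbT cats1 IH.
Qed.

(** This is [T_can] of the reversed composition, in a form where a part put in front of [a] becomes
    a new top row. *)
Definition canon (a : seq nat) : tableau := reshape (rev a) (iota 1 (sumn a)).

Lemma canon_flatten a : flatten (canon a) = iota 1 (sumn a).
Proof. by rewrite reshapeKr // size_iota sumn_rev. Qed.

Lemma canon_cons m a : canon (m :: a) = rcons (canon a) (iota (sumn a).+1 m).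
Proof.
rewrite /canon rev_cons reshape_rcons ?size_iota ?sumn_rev /= 1?addnC //.
by rewrite iotaD take_size_cat ?drop_size_cat ?size_iota // add1n.
Qed.

(** Each step number exceeds all earlier ones, so a new row goes on top; it then is the topmost row
    of its length at each later step of its run. *)
Lemma record_canon a : all (leq 1) a -> record (colseq a) = canon a.
Proof.
elim: a => //= m a IH /andP[m0 /IH {}IH].
rewrite colseq_cons canon_cons.
case: m m0 => // m _; elim: m => [|m IHm].
  rewrite cats1 record_rcons IH /record_step /= size_colseq /new_row.
  have hl r : r \in canon a -> head 0 r < (sumn a).+1.
    case: r => [//|x r] rT; have : x \in flatten (canon a).
      by apply/flattenP; exists (x :: r); rewrite ?mem_head.
    by rewrite canon_flatten mem_iota add1n => /andP[].
  rewrite (eq_in_filter (a2 := predT)) ?filter_predT; last by move=> r /hl ->.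
  rewrite (eq_in_filter (a2 := pred0)) ?filter_pred0 ?cats1 //.
  by move=> r /hl; rewrite ltnNge => /negbTE ->.
rewrite !(iota_rcons _ m.+1) -rcons_cat record_rcons IHm /record_step [_.2]/=.
rewrite append_topmost_rcons ?size_iota //= size_cat size_colseq /= size_iota.
by rewrite addSn.
Qed.

(** The canonical tableau contains every step number, so [record_col] reads off the column of every
    step, both for [w] and for [colseq a]. *)
Lemma Q_hat_canon w a : all (leq 1) a -> size w = sumn a ->
  (Q_hat w == canon a) = (cols [::] w == colseq a).
Proof.
move=> a0 sw; rewrite /Q_hat PQ_hatE /=; apply/eqP/eqP => [e|->]; last first.
  exact: record_canon.
apply: (@eq_from_nth _ 0) => [|j]; rewrite size_cols ?size_colseq // sw => lt.
have : j.+1 \in flatten (canon a) by rewrite canon_flatten mem_iota /= add1n ltnS.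
case/flattenP=> r rT jr; have hi : index j.+1 r < size r by rewrite index_mem.
have hj : nth 0 r (index j.+1 r) = j.+1 by apply: nth_index.
have := rT; rewrite -{1}e => /record_col /(_ hi) [_]; rewrite hj /= => ->.
have := rT; rewrite -(record_canon a0) => /record_col /(_ hi) [_].
by rewrite hj.
Qed.

(** * The words of fillings that lie in K_alpha *)

Lemma rev_w_r T : rev (w_r T) = word T.
Proof.
rewrite /w_r rev_flatten -map_comp (eq_map (g := id)) ?map_id //.
exact: revK.
Qed.

Lemma perm_w_r T : perm_eq (w_r T) (flatten T).
Proof. by elim: T => //= r T IH; rewrite /w_r /= perm_cat ?perm_rev. Qed.

Lemma K_setP n alpha T : is_composition n alpha -> pairwise part_rel alpha ->
  T \in fillings n alpha -> rows_increase T ->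
  (w_r T \in K_set n alpha) = pairwise tight T.
Proof.
move=> ca pa; rewrite mem_fillings // => /andP[/eqP sT pT] rT.
have /andP[a0 /eqP sa] := ca.
have rT' : all (fun r => (0 < size r) && sorted ltn r) T.
  apply/allP=> r rinT; rewrite (allP rT) // andbT.
  by apply: (allP a0); rewrite -sT; apply: map_f.
have uT : uniq (flatten T) by rewrite (perm_uniq pT) iota_uniq.
have pT' : pairwise part_rel (shape T) by rewrite sT.
have [stair _] := run_word_tight rT' uT pT'.
rewrite /K_set mem_filter rev_w_r mem_permutations.
rewrite (permPl (perm_w_r T)) pT andbT.
rewrite /T_can -sa -/(canon alpha) Q_hat_canon ?size_word ?sT //.
rewrite /P_hat PQ_hatE /= -sT.
apply/idP/idP => [/andP[/eqP h1 /eqP h2]|/(proj2 stair) [-> ->]].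
  exact/(proj1 stair).
by rewrite !eqxx.
Qed.

(** This is the form in which the shuffle hypothesis enters. A part coming from [lam] bounds the
    later parts of [lam], and all other parts are ones. *)
Lemma shuffle_part_rel lam k alpha :
  is_partition lam -> is_shuffle lam (nseq k 1) alpha ->
  pairwise part_rel alpha.
Proof.
case/andP=> _ + [m [sm em en]]; rewrite -em.
have {en} : all (pred1 1) (mask (map negb m) alpha).
  by rewrite en all_pred1_nseq.
elim: m alpha {em} sm => [|b m IH] [|a alpha] //= [sm].
have memb x : x \in alpha ->
    x \in mask m alpha \/ x \in mask (map negb m) alpha.
  elim: m alpha {IH} sm => [|[] m IHm] [|y u] //= [/IHm h]; rewrite !inE.
    by case/predU1P=> [->|/h [->|]]; rewrite ?eqxx ?orbT; auto.
  by case/predU1P=> [->|/h [|->]]; rewrite ?eqxx ?orbT; auto.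
case: b => /=.
  move=> h1; rewrite (path_sortedE (rev_trans leq_trans)) => /andP[/allP ha hs].
  rewrite (IH alpha) // andbT; apply/allP=> x /memb [/ha ax|/(allP h1) /eqP ->].
    by apply/orP; right.
  by rewrite /part_rel; case: (a) => [|[]].
case/andP=> /eqP -> h1 hs; rewrite (IH alpha) // andbT.
by apply/allP.
Qed.

(** * Standard fillings *)

Lemma swapK i : involutive (swap i).
Proof.
move=> x; rewrite /swap; case: (eqVneq x i) => [->|n1].
  by rewrite eqxx gtn_eqF.
case: (eqVneq x i.+1) => [->|n2]; first by rewrite eqxx.
by rewrite (negbTE n1) (negbTE n2).
Qed.

Lemma swap_lt i x y : ~ (x = i /\ y = i.+1) -> x < y -> swap i x < swap i y.
Proof.
rewrite /swap => h lt.
by case: (x =P i) => ?; case: (x =P i.+1) => ?; case: (y =P i) => ?;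
  case: (y =P i.+1) => ?; lia.
Qed.

Lemma swap_i i : swap i i = i.+1.
Proof. by rewrite /swap eqxx. Qed.

Lemma swap_iS i : swap i i.+1 = i.
Proof. by rewrite -[RHS](swapK i) swap_i. Qed.

Lemma row_index_lt (T : tableau) a c : c < size (nth [::] T a) -> a < size T.
Proof. by move=> lt; rewrite ltnNge; apply/negP => le; rewrite nth_default in lt. Qed.

Lemma entry_swap i T a c : c < size (nth [::] T a) ->
  entry (swap_tab i T) a c = swap i (entry T a c).
Proof.
move=> lt; have aT := row_index_lt lt.
by rewrite /entry /swap_tab (nth_map [::]) // (nth_map 0).
Qed.

Lemma shape_swap i T : shape (swap_tab i T) = shape T.
Proof. by rewrite /shape -map_comp; apply: eq_map => r /=; rewrite size_map. Qed.

Lemma size_row_swap i T a : size (nth [::] (swap_tab i T) a) = size (nth [::] T a).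
Proof.
have := congr1 (fun s => nth 0 s a) (shape_swap i T).
case: (ltnP a (size T)) => lt; last by rewrite !nth_default ?size_map.
by rewrite /shape !(nth_map [::]) ?size_map.
Qed.

Lemma swap_fillings n alpha i T : is_composition n alpha -> 0 < i < n ->
  T \in fillings n alpha -> swap_tab i T \in fillings n alpha.
Proof.
move=> ca /andP[i0 lin]; rewrite !mem_fillings // shape_swap => /andP[-> pT] /=.
rewrite -map_flatten (perm_trans (perm_map _ pT)) //.
apply: uniq_perm; rewrite ?iota_uniq ?map_inj_uniq ?iota_uniq //.
  exact: inv_inj (swapK i).
have sw x : x \in iota 1 n -> swap i x \in iota 1 n.
  rewrite !mem_iota add1n /swap; case: eqP => [_ _|_]; first by rewrite !ltnS.
  by case: eqP => // _ _; rewrite i0 ltnS ltnW.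
move=> x; apply/mapP/idP => [[y yI ->]|xI]; first exact: sw.
by exists (swap i x); rewrite ?swapK ?sw.
Qed.

Lemma w_r_swap i T : w_r (swap_tab i T) = map (swap i) (w_r T).
Proof.
rewrite /w_r map_flatten -!map_comp; congr flatten.
by apply: eq_map => r /=; rewrite map_rev.
Qed.

Lemma entry_mem T a c : c < size (nth [::] T a) -> entry T a c \in flatten T.
Proof.
move=> lt; have aT := row_index_lt lt.
by apply/flattenP; exists (nth [::] T a); apply: mem_nth.
Qed.

Lemma row_ofP T x : x \in flatten T -> x \in nth [::] T (row_of T x).
Proof.
move/flattenP=> [r rT xr]; apply: (@nth_find _ [::] (fun r => x \in r)).
by apply/hasP; exists r.
Qed.

Lemma col_of_lt T x : x \in flatten T -> col_of T x < size (nth [::] T (row_of T x)).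
Proof. by move=> xT; rewrite index_mem row_ofP. Qed.

Lemma entryK T x : x \in flatten T -> entry T (row_of T x) (col_of T x) = x.
Proof. by move=> xT; rewrite /entry nth_index ?row_ofP. Qed.

Lemma row_of_nth T a x : uniq (flatten T) -> x \in nth [::] T a -> row_of T x = a.
Proof.
rewrite /row_of; elim: T a => [|r T IH] [|a] //=.
  by move=> _ ->.
rewrite cat_uniq => /and3P[_ /hasPn h u] xa.
have xT : x \in flatten T.
  apply/flattenP; exists (nth [::] T a) => //.
  by apply/mem_nth/row_index_lt; rewrite -index_mem in xa; exact: xa.
by rewrite (negbTE (h x xT)) (IH a).
Qed.

Lemma index_w_r_row T x y : uniq (flatten T) -> x \in flatten T ->
  y \in flatten T -> row_of T x < row_of T y -> index x (w_r T) < index y (w_r T).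
Proof.
elim: T => //= r T IH; rewrite cat_uniq => /and3P[_ _ u].
rewrite !mem_cat /w_r /= !index_cat !mem_rev /row_of /=.
case: (boolP (x \in r)) (boolP (y \in r)) => [xr|xr] [yr|yr] //= xT yT lt.
  by apply: ltn_addr; rewrite index_mem mem_rev.
by rewrite ltn_add2l; apply: IH.
Qed.

Lemma index_rev_nth r c : uniq r -> c < size r ->
  index (nth 0 r c) (rev r) = (size r - c.+1)%N.
Proof.
move=> u lt; have lt' : size r - c.+1 < size (rev r) by rewrite size_rev; lia.
rewrite -[in LHS](_ : nth 0 (rev r) (size r - c.+1) = nth 0 r c).
  by rewrite index_uniq // rev_uniq.
have ltn : size r - c.+1 < size r by lia.
by rewrite (nth_rev _ ltn); congr nth; lia.
Qed.

Lemma index_w_r_col T x y : uniq (flatten T) -> x \in flatten T ->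
  y \in flatten T -> row_of T x = row_of T y -> col_of T x < col_of T y ->
  index y (w_r T) < index x (w_r T).
Proof.
rewrite /col_of; elim: T => //= r T IH; rewrite cat_uniq => /and3P[ur _ u].
rewrite !mem_cat /w_r /= !index_cat !mem_rev /row_of /=.
case: (boolP (x \in r)) (boolP (y \in r)) => [xr|xr] [yr|yr] //=; last first.
  by move=> xT yT [e]; rewrite ltn_add2l; apply: IH.
move=> _ _ _ lt.
rewrite -[x in X in _ < X](nth_index 0 xr) -[y in X in X < _](nth_index 0 yr).
have := index_mem x r; have := index_mem y r; rewrite xr yr => h1 h2.
by rewrite !index_rev_nth //; lia.
Qed.

(** * Increasing columns as a pairwise relation on rows *)

Definition below (r s : seq nat) : bool :=
  all (fun i => (i < size r) ==> (nth 0 r i < nth 0 s i)) (iota 0 (size s)).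

Lemma belowP r s : reflect (forall i, i < size s -> i < size r ->
  nth 0 r i < nth 0 s i) (below r s).
Proof.
apply: (iffP allP) => h i.
  by move=> lt; apply/implyP/h; rewrite mem_iota.
by rewrite mem_iota => /h /implyP.
Qed.

Lemma tight_below r s : tight r s -> below r s.
Proof. by move/tightP=> h; apply/belowP => i lt; have [] := h i lt. Qed.

Lemma column_cons r T j : column (r :: T) j =
  if j < size r then nth 0 r j :: column T j else column T j.
Proof. by rewrite /column /=; case: ifP. Qed.

Lemma below_columns T :
  (forall j, sorted ltn (column T j)) <-> pairwise below T.
Proof.
elim: T => [|r T IH] //=; split=> [h|/andP[/allP hr /IH h] j].
  apply/andP; split; last first.
    apply/IH => j; move: (h j); rewrite column_cons; case: ifP => // _.
    exact: path_sorted.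
  apply/allP=> s sT; apply/belowP => j js jr.
  move: (h j); rewrite column_cons jr /= (path_sortedE ltn_trans).
  case/andP=> /allP a _; apply: a; apply: (map_f (fun r => nth 0 r j)).
  by rewrite mem_filter js.
rewrite column_cons; case: ifP => // jr.
rewrite /= (path_sortedE ltn_trans) h andbT; apply/allP => x /mapP[s].
by rewrite mem_filter => /andP[js sT] ->; apply: (belowP _ _ (hr s sT)).
Qed.

Lemma size_row_flatten (T : tableau) r : r \in T -> size r <= size (flatten T).
Proof.
elim: T => //= q T IH; rewrite inE size_cat => /predU1P[->|/IH le].
  exact: leq_addr.
exact: leq_trans le (leq_addl _ _).
Qed.

Lemma mem_SET n alpha T : is_composition n alpha ->
  (T \in SET n alpha) = [&& T \in fillings n alpha, rows_increase T & pairwise below T].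
Proof.
move=> ca; rewrite mem_filter andbC.
case: (boolP (T \in fillings n alpha)) => //= Tf; congr andb.
apply/allP/idP => [h|/below_columns h j _]; last exact: h.
apply/below_columns => j; case: (ltnP j n) => lt; first by apply: h; rewrite mem_iota.
(* No row has more than [n] cells, so the columns from index [n] on are empty. *)
rewrite /column (eq_in_filter (a2 := pred0)) ?filter_pred0 // => r rT /=.
apply/negbTE; rewrite -leqNgt; apply: leq_trans lt.
move: Tf; rewrite mem_fillings // => /andP[_ /perm_size]; rewrite size_iota => <-.
exact: size_row_flatten.
Qed.

Lemma SET_SIT n alpha T :
  is_composition n alpha -> T \in SET n alpha -> T \in SIT n alpha.
Proof.
move=> ca; rewrite mem_SET // => /and3P[Tf rT /below_columns h].
by rewrite mem_filter Tf rT h.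
Qed.

Lemma pairwise_entry (R : rel (seq nat)) T :
  (forall a b, a < b < size T -> R (nth [::] T a) (nth [::] T b)) -> pairwise R T.
Proof.
move=> h; apply/(pairwiseP [::]) => a b aT bT lt; apply: h.
by rewrite lt.
Qed.

Lemma rows_increase_lt T a c d : rows_increase T -> c < d < size (nth [::] T a) ->
  entry T a c < entry T a d.
Proof.
move=> /allP rT /andP[cd dT].
have aT := row_index_lt dT.
apply: (sorted_ltn_nth ltn_trans 0 (rT _ (mem_nth [::] aT))) => //.
by rewrite inE (ltn_trans cd).
Qed.

Lemma below_lt T a b c : pairwise below T -> a < b ->
  c < size (nth [::] T a) -> c < size (nth [::] T b) -> entry T a c < entry T b c.
Proof.
move=> /(pairwiseP [::]) h ab ca cb; have bT := row_index_lt cb.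
exact: (belowP _ _ (h a b (ltn_trans ab bT) bT ab)).
Qed.

Lemma rows_increase_swap i T : rows_increase T -> uniq (flatten T) ->
  row_of T i <> row_of T i.+1 -> rows_increase (swap_tab i T).
Proof.
move=> /allP rT uT ne; apply/allP=> _ /mapP[r rinT ->].
have [a aT er] := nthP [::] rinT.
rewrite sorted_map; apply: (sub_in_sorted (P := mem r)) (rT r rinT).
  move=> x y xr yr /= lt; apply: swap_lt lt => -[ex ey]; apply: ne; subst x y.
  by rewrite (row_of_nth (a := a)) ?er // (row_of_nth (a := a)) ?er.
exact/allP.
Qed.

Lemma below_swap i T : uniq (flatten T) -> i \in flatten T -> i.+1 \in flatten T ->
  col_of T i <> col_of T i.+1 -> pairwise below T -> pairwise below (swap_tab i T).
Proof.
move=> uT iT sT ne bT; apply: pairwise_entry => a b /andP[ab _].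
apply/belowP => c; rewrite !size_row_swap => cb ca.
rewrite -!/(entry (swap_tab i T) _ c) !entry_swap //.
apply: swap_lt; last exact: below_lt bT ab ca cb.
move=> [ea eb]; apply: ne.
have col x d : entry T d c = x -> c < size (nth [::] T d) -> col_of T x = c.
  move=> ed lt; have xd : x \in nth [::] T d by rewrite -ed mem_nth.
  rewrite /col_of (row_of_nth uT xd) -ed /entry index_uniq //.
  have /flattenP/= := entry_mem lt; rewrite ed => _.
  have dT := row_index_lt lt.
  elim: (T) d uT {xd ed lt bT iT sT ea eb ca cb ab} dT => // r T' IH [|d] /=.
    by rewrite cat_uniq => /and3P[].
  by rewrite cat_uniq => /and3P[_ _ u] lt; apply: IH.
by rewrite (col _ _ ea ca) (col _ _ eb cb).
Qed.

(* The two entries that [tight] compares lie in different rows, the smaller in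
   the lower one, so undoing a swap that put [i.+1] below [i] keeps it. *)
Lemma tight_swap i T : uniq (flatten T) -> row_of T i < row_of T i.+1 ->
  pairwise tight (swap_tab i T) -> pairwise tight T.
Proof.
move=> uT lti /(pairwiseP [::]) dT; apply: pairwise_entry => a b /andP[ab bT].
have aT := ltn_trans ab bT.
have := dT a b; rewrite !inE size_map => /(_ aT bT ab) /tightP.
rewrite !size_row_swap => h; apply/tightP => c cb.
have lt d : d < size (nth [::] T a) ->
    entry (swap_tab i T) a d < entry (swap_tab i T) b c -> entry T a d < entry T b c.
  move=> da; rewrite !entry_swap // => /(@swap_lt i); rewrite !swapK; apply.
  case=> /(congr1 (swap i)) + /(congr1 (swap i)); rewrite !swapK swap_i swap_iS.
  move=> ea eb; move: lti.
  rewrite -ea -eb (row_of_nth (a := b) uT) ?mem_nth //.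
  by rewrite (row_of_nth (a := a) uT) ?mem_nth // ltnNge (ltnW ab).
have [h1 h2] := h c cb; split=> [ca|sa]; first exact: lt (h1 ca).
by apply: lt (h2 sa); apply: leq_trans sa; rewrite ltnS.
Qed.

(** * The effect of exchanging [i] and [i.+1] in a tableau of SET(alpha) *)

Section Action.
Variables (n : nat) (alpha : seq nat) (i : nat) (T : tableau).
Hypotheses (ca : is_composition n alpha) (pa : pairwise part_rel alpha).
Hypotheses (lti : 0 < i < n) (TS : T \in SET n alpha).

Let Tf : T \in fillings n alpha.
Proof. by move: TS; rewrite mem_SET // => /and3P[]. Qed.
Let Tr : rows_increase T.
Proof. by move: TS; rewrite mem_SET // => /and3P[]. Qed.
Let Tb : pairwise below T.
Proof. by move: TS; rewrite mem_SET // => /and3P[]. Qed.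
Let Tp : perm_eq (flatten T) (iota 1 n).
Proof. by move: Tf; rewrite mem_fillings // => /andP[]. Qed.
Let Tu : uniq (flatten T).
Proof. by rewrite (perm_uniq Tp) iota_uniq. Qed.
Let iT : i \in flatten T.
Proof.
by rewrite (perm_mem Tp) mem_iota; case/andP: lti => -> /ltnW; rewrite add1n ltnS.
Qed.
Let sT : i.+1 \in flatten T.
Proof. by rewrite (perm_mem Tp) mem_iota add1n ltnS; case/andP: lti. Qed.

Let ec := entryK iT.
Let ed := entryK sT.
Let cT := col_of_lt iT.
Let dT := col_of_lt sT.

Lemma Des_L_w_r : (row_of T i.+1 < row_of T i) ||
   ((row_of T i == row_of T i.+1) && (col_of T i < col_of T i.+1)) ->
  Des_L (w_r T) i.
Proof.
case/orP=> [|/andP[/eqP]]; first exact: index_w_r_row.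
exact: index_w_r_col.
Qed.

(** If [i] were also strictly below [i.+1], the cell in the column of [i] and the row of [i.+1]
    would hold a number strictly between them. *)
Lemma SET_Des_L : col_of T i < col_of T i.+1 -> Des_L (w_r T) i.
Proof.
move=> lt; apply: Des_L_w_r; rewrite lt andbT.
case: (ltngtP (row_of T i) (row_of T i.+1)) => //= ab.
have cb := ltn_trans lt dT.
have := below_lt Tb ab cT cb; rewrite ec => h.
have := @rows_increase_lt T _ _ _ Tr (introT andP (conj lt dT)); rewrite ed => h'.
by have := leq_trans h' h; rewrite ltnn.
Qed.

(** The cell in the row of [i] and the column of [i.+1] holds at most [i], so [i.+1] cannot lie
    below it in that column. *)
Lemma SET_row_lt : col_of T i.+1 <= col_of T i -> row_of T i < row_of T i.+1.
Proof.
move=> le; have da := leq_ltn_trans le cT.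
have {}le : entry T (row_of T i) (col_of T i.+1) <= i.
  move: le; rewrite leq_eqVlt => /predU1P[->|lt]; first by rewrite ec.
  apply: ltnW; rewrite -[X in _ < X]ec; apply: rows_increase_lt => //.
  by rewrite lt.
case: (ltngtP (row_of T i) (row_of T i.+1)) => // [ba|e].
  have := below_lt Tb ba dT da; rewrite ed => h.
  by have := leq_trans h le; rewrite ltnNge leqnSn.
by move: le; rewrite e ed ltnn.
Qed.

Lemma row_lt_Des_L : row_of T i < row_of T i.+1 -> Des_L (w_r T) i = false.
Proof. by move/(index_w_r_row Tu iT sT) => lt; apply/negbTE; rewrite -leqNgt ltnW. Qed.

Let rows_swap : col_of T i.+1 <= col_of T i -> rows_increase (swap_tab i T).
Proof.
move/SET_row_lt => lt; apply: rows_increase_swap => // e.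
by rewrite e ltnn in lt.
Qed.

Lemma swap_notin_K : col_of T i = col_of T i.+1 ->
  map (swap i) (w_r T) \notin K_set n alpha.
Proof.
move=> e; have le : col_of T i.+1 <= col_of T i by rewrite e.
rewrite -w_r_swap K_setP ?rows_swap ?swap_fillings //; apply/negP => dT'.
have bT : pairwise below (swap_tab i T) := sub_pairwise tight_below dT'.
have := below_lt bT (SET_row_lt le) (c := col_of T i).
have db : col_of T i < size (nth [::] T (row_of T i.+1)) by rewrite e.
have eb : entry T (row_of T i.+1) (col_of T i) = i.+1 by rewrite e.
rewrite !size_row_swap => /(_ cT db).
by rewrite !entry_swap // ec eb swap_i swap_iS ltnNge leqnSn.
Qed.

Lemma swap_in_SET : col_of T i.+1 < col_of T i -> swap_tab i T \in SET n alpha.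
Proof.
move=> lt; rewrite mem_SET // swap_fillings // rows_swap 1?ltnW //=.
by apply: below_swap => // e; rewrite e ltnn in lt.
Qed.

(** Read contrapositively: the tableaux whose words are outside K_alpha stay so under the action, so
    sending them to 0 is compatible with it. *)
Lemma swap_in_K : col_of T i.+1 < col_of T i ->
  map (swap i) (w_r T) \in K_set n alpha -> w_r T \in K_set n alpha.
Proof.
move=> lt; rewrite -w_r_swap !K_setP ?swap_fillings ?rows_swap ?(ltnW lt) //.
by apply: tight_swap => //; apply/SET_row_lt/ltnW.
Qed.

End Action.

(** * The induced homomorphism and its uniqueness *)

Import GRing.Theory.
Local Open Scope ring_scope.

Lemma bvec_expand (F : fieldType) (I : choiceType) (B : seq I) (v : span_on F B) :
  v = \sum_t v t *: bvec F B (val t).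
Proof.
apply/ffunP => t; rewrite sum_ffunE (bigD1 t) //= !ffunE eqxx big1 ?addr0.
  by rewrite /GRing.scale /= mulr1.
move=> u ne; rewrite !ffunE /GRing.scale /= (inj_eq val_inj) eq_sym (negbTE ne).
by rewrite mulr0.
Qed.

Lemma eq_on_bvec (F : fieldType) (I : choiceType) (B : seq I) (W : vectType F)
    (f g : 'Hom(span_on F B, W)) :
  (forall x, x \in B -> f (bvec F B x) = g (bvec F B x)) -> f = g.
Proof.
move=> h; apply/lfunP => v; rewrite (bvec_expand v) !linear_sum.
by apply: eq_bigr => t _; rewrite !linearZ /= h // (valP t).
Qed.

(** The values of [delta] on SET(alpha), as the factorization through [Gamma] forces. *)
Definition delta_tilde (F : fieldType) (n : nat) (alpha : seq nat) :
    'Hom(X_mod F n alpha, Y_mod F n alpha) :=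
  linext (fun T =>
    if w_r T \in K_set n alpha then bvec F (K_set n alpha) (w_r T) else 0).

(** Checked on basis tableaux. For [i] left of [i.+1] the word has a descent and both sides fix it;
    for [i] to the right both sides swap; in a common column the swapped word leaves K_alpha and
    both sides vanish. *)
Lemma delta_tilde_hom (F : fieldType) n alpha :
  is_composition n alpha -> pairwise part_rel alpha ->
  hecke0_hom n (X_pi F n alpha) (Y_pi F n alpha) (delta_tilde F n alpha).
Proof.
move=> ca pa i lti u.
suff h : (delta_tilde F n alpha \o X_pi F n alpha i =
    Y_pi F n alpha i \o delta_tilde F n alpha)%VF.
  by have := congr1 (fun f : 'Hom(_, _) => f u) h; rewrite !comp_lfunE.
apply: eq_on_bvec => T TS; rewrite !comp_lfunE /X_pi /= linext_bvec //.
rewrite [delta_tilde F n alpha (bvec _ _ T)]linext_bvec //.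
case: (ltngtP (col_of T i) (col_of T i.+1)) => lt.
- rewrite [LHS]linext_bvec //; case: ifP => wK; last by rewrite linear0.
  by rewrite [RHS]linext_bvec // (SET_Des_L ca lti TS lt).
- have le := ltnW lt; rewrite [LHS]linext_bvec ?swap_in_SET // w_r_swap.
  case: (boolP (w_r T \in _)) => [wK|nK].
    by rewrite [RHS]linext_bvec // (row_lt_Des_L ca lti TS (SET_row_lt ca lti TS le)).
  rewrite linear0; case: ifP => // /(swap_in_K ca pa lti TS lt).
  by rewrite (negbTE nK).
- rewrite linear0; case: ifP => wK; last by rewrite linear0.
  rewrite [RHS]linext_bvec // (row_lt_Des_L ca lti TS (SET_row_lt ca lti TS _)) ?lt //.
  by rewrite (negbTE (swap_notin_K ca pa lti TS lt)).
Qed.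

Theorem proposition5p5 (R : realType) (n k : nat) (lam alpha : seq nat) :
  is_composition n alpha ->
  is_partition lam ->
  is_shuffle lam (nseq k 1%N) alpha ->
  exists! deltat : 'Hom(X_mod R[i] n alpha, Y_mod R[i] n alpha),
    hecke0_hom n (X_pi R[i] n alpha) (Y_pi R[i] n alpha) deltat /\
    delta R[i] n alpha = (deltat \o Gamma R[i] n alpha)%VF.
Proof.
move=> ca plam sh; have pa := shuffle_part_rel plam sh.
exists (delta_tilde R[i] n alpha); split.
  split; first exact: delta_tilde_hom.
  apply: eq_on_bvec => T TS; rewrite comp_lfunE !linext_bvec //.
  (* Outside SET(alpha) [Gamma] vanishes, and so does [delta]: a word in K_alpha would make [T]
     tight, hence increasing along columns. *)
  case: (boolP (T \in SET n alpha)) => [TE|/negP nTE].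
    by rewrite [RHS]linext_bvec.
  rewrite linear0; case: ifP => // wK; move: nTE.
  have : T \in SIT n alpha by [].
  rewrite mem_filter => /andP[/andP[rT _] Tf].
  rewrite mem_SET // rT Tf /= (sub_pairwise tight_below) //.
  by rewrite -(K_setP ca pa Tf rT).
(* Each basis vector of X_alpha is the image under [Gamma] of the same tableau in SIT(alpha), so the
   factorization fixes the value of [f] there. *)
move=> f [_ ef]; apply: eq_on_bvec => T TE.
have TS := SET_SIT ca TE.
have := congr1 (fun g : 'Hom(_, _) => g (bvec _ _ T)) ef.
rewrite comp_lfunE !linext_bvec // TE => <-.
by [].
Qed.
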